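(* Let $p\ge1$ and consider the model $\mathbf Y=\mathbf X+\mathbf Z_1$, $\mathbf X=\mathbf 1\Theta+\Sigma^{1/2}\mathbf Z_2$, where $\mathbf Z_1=(Z_{11},\dots,Z_{1p})$ has i.i.d. standard Cauchy entries, $\mathbf Z_2=(Z_{21},\dots,Z_{2p})$ has i.i.d. standard Gaussian entries independent of $\mathbf Z_1$, $\mathbf 1\in\mathbb R^p$ is the vector of ones, $\Sigma$ is a known $p\times p$ positive definite covariance matrix, and $\Theta\in\mathbb R$ has the improper flat prior. Fix observed data $\mathbf y$. Then (1) the Gibbs sampler under the centred parametrisation $\mathcal P_0=(\mathbf X,\Theta)$ fails to be geometrically ergodic; (2) the Gibbs sampler under the non-centred parametrisation $\mathcal P_1=(\tilde{\mathbf X},\Theta)$, $\tilde{\mathbf X}=\mathbf X-\mathbf 1\Theta$, is uniformly ergodic.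
   Context: For a parametrisation $(\mathbf U,\Theta)$ with $\mathbf U\in\{\mathbf X,\tilde{\mathbf X}\}$, the Gibbs sampler started at $\Theta_0$ iterates, for $n\ge1$: draw $\mathbf U_n\sim\mathcal L(\mathbf U\mid\mathbf Y=\mathbf y,\Theta=\Theta_{n-1})$, then $\Theta_n\sim\mathcal L(\Theta\mid\mathbf Y=\mathbf y,\mathbf U=\mathbf U_n)$. It is called geometrically ergodic if the marginal chain $\{\Theta_n\}$ satisfies $\|\mathcal L(\Theta_n\mid\mathbf Y=\mathbf y,\Theta_0)-\mathcal L(\Theta\mid\mathbf Y=\mathbf y)\|_{TV}\le M(\Theta_0)r^n$ for all $n$, for some $r<1$ and some function $M$, and uniformly ergodic if in addition $M$ can be taken bounded. *)

(* Defs.v *)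
From HB Require Import structures.
From mathcomp Require Import all_boot all_order all_algebra.
From mathcomp Require Import all_classical all_reals all_analysis.
Set Implicit Arguments. Unset Strict Implicit. Unset Printing Implicit Defensive.
Import Order.TTheory GRing.Theory Num.Theory.
Import numFieldNormedType.Exports.
Local Open Scope classical_set_scope.
Local Open Scope ring_scope.

Section GibbsDefs.
Variable R : realType.
Notation leb := (@lebesgue_measure R).

(* Lebesgue integral of a nonnegative function on R^n = 'rV[R]_n,
   written as the iterated integral over the coordinates (Tonelli). *)
Fixpoint rvint (n : nat) : ('rV[R]_n -> \bar R) -> \bar R :=
  match n return ('rV[R]_n -> \bar R) -> \bar R with
  | 0 => fun f => f 0
  | n'.+1 => fun f =>
      (\int[leb]_(t in setT) rvint (fun v : 'rV[R]_n' =>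
                    f (row_mx (\row_(j < 1) t) v)))%E
  end.

Definition cauchy_pdf (t : R) : R := (pi * (1 + t ^+ 2))^-1.

Definition posdef (p : nat) (S : 'M[R]_p) : Prop :=
  S^T = S /\ forall v : 'rV[R]_p, v != 0 -> 0 < (v *m S *m v^T) 0 0.

Definition gauss_pdf (p : nat) (S : 'M[R]_p) (v : 'rV[R]_p) : R :=
  (Num.sqrt ((2 * pi) ^+ p * \det S))^-1 *
  expR (- (v *m invmx S *m v^T) 0 0 / 2).

Definition ones (p : nat) : 'rV[R]_p := const_mx 1.

(* joint posterior (unnormalised) density of (X, Theta) given Y = y,
   flat prior on Theta: Y = X + Z1, X = 1 Theta + S^(1/2) Z2 *)
Definition joint_centred (p : nat) (S : 'M[R]_p) (y : 'rV[R]_p)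
  (x : 'rV[R]_p) (th : R) : R :=
  (\prod_(i < p) cauchy_pdf (y 0 i - x 0 i)) * gauss_pdf S (x - th *: ones p).

(* joint posterior (unnormalised) density of (Xtilde, Theta) given Y = y,
   Xtilde = X - 1 Theta *)
Definition joint_noncentred (p : nat) (S : 'M[R]_p) (y : 'rV[R]_p)
  (xt : 'rV[R]_p) (th : R) : R :=
  (\prod_(i < p) cauchy_pdf (y 0 i - xt 0 i - th)) * gauss_pdf S xt.

(* Generic two-block Gibbs sampler from an (unnormalised) joint density
   pi(u, theta) on R^p x R. *)
Section Gibbs.
Variables (p : nat) (dens : 'rV[R]_p -> R -> R).

Definition condU (th : R) (u : 'rV[R]_p) : \bar R :=
  ((dens u th)%:E / rvint (fun u' => (dens u' th)%:E))%E.

Definition condTheta (u : 'rV[R]_p) (th : R) : \bar R :=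
  ((dens u th)%:E / \int[leb]_(t in setT) (dens u t)%:E)%E.

(* transition density of the marginal chain {Theta_n} *)
Definition trans_dens (th th' : R) : \bar R :=
  rvint (fun u => condU th u * condTheta u th')%E.

Fixpoint nstep (n : nat) (th0 : R) (A : set R) : \bar R :=
  match n with
  | 0 => (\1_A th0)%:E
  | n'.+1 => (\int[leb]_(t in setT) (trans_dens th0 t * nstep n' t A))%E
  end.

Definition post_Theta (A : set R) : \bar R :=
  ((\int[leb]_(t in A) rvint (fun u => (dens u t)%:E)) /
   (\int[leb]_(t in setT) rvint (fun u => (dens u t)%:E)))%E.

Definition tv_dist (n : nat) (th0 : R) : \bar R :=
  ereal_sup [set `|(nstep n th0 A - post_Theta A)%E|%E
            | A in [set A : set R | measurable A]].

Definition geometrically_ergodic : Prop :=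
  exists (r : R) (M : R -> R), 0 <= r < 1 /\
    forall th0 n, (tv_dist n th0 <= (M th0 * r ^+ n)%:E)%E.

Definition uniformly_ergodic : Prop :=
  exists (r : R) (M : R -> R), 0 <= r < 1 /\ (exists B : R, forall t, M t <= B) /\
    forall th0 n, (tv_dist n th0 <= (M th0 * r ^+ n)%:E)%E.
End Gibbs.
End GibbsDefs.

(* Main.v *)
Require Import Defs.
From HB Require Import structures.
From mathcomp Require Import all_boot all_order all_algebra.
From mathcomp Require Import all_classical all_reals all_analysis.
From mathcomp Require Import measurable_realfun ring lra.
Set Implicit Arguments. Unset Strict Implicit. Unset Printing Implicit Defensive.
Import Order.TTheory GRing.Theory Num.Theory.
Import numFieldNormedType.Exports.
Local Open Scope classical_set_scope.
Local Open Scope ring_scope.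

(**
  Write d(u, t) for the joint density of the non-centred parametrisation; the
  centred one is d(x - t 1, t). The elementary inequality
  1 + (a - b)^2 <= 2 (1 + a^2) (1 + b^2), applied to each Cauchy factor, together with
  the two-sided comparison of the quadratic form of S^-1 with the Euclidean
  norm, gives
    c (1 + t^2)^-p prod_i lo(u_i) <= d(u, t) <= C (1 + t^2)^-p prod_i 1 / (1 + u_i^2)
  with lo(s) = exp(- l s^2) / (1 + s^2), and the upper bound survives
  multiplication by the exponential of a linear form in u.

  Non-centred chain: the factors (1 + s^2)^-p of the current state s cancel in
  the full conditional of U, so the transition density is bounded below by
  eta (1 + t^2)^-p uniformly in s (Doeblin's condition), and the oscillation of
  the n-step probabilities contracts geometrically.

  Centred chain: the full conditional of Theta is Gaussian around a linear form
  of x whose value at 1 is 1, so the increments of the chain have exponential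
  moments bounded uniformly in the current state, whence
  P^n(0, ]T, oo[) <= D^n exp(-T). The stationary law has mass of order
  at least T^(-2p) on ]T, oo[; taking T proportional to n contradicts any geometric rate.
*)

(** * Lebesgue integrals on the real line *)

Section integral_facts.
Variable R : realType.
Local Notation leb := (@lebesgue_measure R).

(** The integral of a nonnegative function is a supremum over simple functions below it, and
    whatever lies below [f] lies below [g]. *)
Lemma ge0_le_integralT d (T : measurableType d) (mu : {measure set T -> \bar R})
    (f g : T -> \bar R) :
  (forall x, 0 <= f x)%E -> (forall x, f x <= g x)%E ->
  (\int[mu]_x f x <= \int[mu]_x g x)%E.
Proof.
move=> f0 fg; have g0 x : (0 <= g x)%E by exact: le_trans (fg x).
rewrite !ge0_integralTE//; apply: ereal_sup_le => _ [h hf <-].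
by exists h => //= x; exact: le_trans (hf x) (fg x).
Qed.

(** The pushforward of Lebesgue measure by the translation agrees with it on half-open intervals,
    hence on all measurable sets; the rest is change of variables. *)
Lemma integral_shift (f : R -> \bar R) (a : R) :
  measurable_fun setT f -> (forall t, 0 <= f t)%E ->
  (\int[leb]_t f (t + a)%R = \int[leb]_t f t)%E.
Proof.
move=> mf f0; pose sh : measurableTypeR R -> measurableTypeR R := fun t => t + a.
have ms : measurable_fun setT sh.
  by apply: measurable_funD => //; exact: measurable_cst.
have E A : measurable A -> lebesgue_measure A = pushforward leb sh A.
  move=> mA.
  apply: (@lebesgue_measure_unique R (pushforward leb sh)) => //= _ [[x z]] _ <-.
  rewrite /pushforward (_ : _ @^-1` _ = `](x - a), (z - a)]%classic); last first.
    by apply/seteqP; split => t /=; rewrite !in_itv/= ltrBlDr lerBrDr.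
  rewrite !lebesgue_measure_itv/= !lte_fin ltrD2r.
  case: ifP => // _; rewrite -!EFinB; congr EFin; ring.
transitivity (\int[pushforward leb sh]_t f t)%E; last first.
  apply: eq_measure_integral => A mA _; exact/esym/E.
by rewrite ge0_integral_pushforward// => t _.
Qed.

(** A zero integral would make [f] vanish almost everywhere; since [f] vanishes nowhere, the whole
    line would be null, against [0, 1] having measure 1. *)
Lemma integral_gt0 (f : R -> \bar R) :
  measurable_fun setT f -> (forall t, 0 < f t)%E -> (0 < \int[leb]_t f t)%E.
Proof.
move=> mf f0; rewrite lt0e integral_ge0 ?andbT; last by move=> t _; exact: ltW.
apply/eqP => I0.
have : (\int[leb]_(x in setT) `|f x| = 0)%E.
  by rewrite -[RHS]I0; apply: eq_integral => t _; rewrite gee0_abs// ltW.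
move=> /(ae_eq_integral_abs leb measurableT mf) [N [mN N0 sN]].
have NT : N = setT.
  apply/seteqP; split => // t _; apply: sN => /= /(_ I) ft0.
  by have := f0 t; rewrite ft0 ltxx.
have : (leb `[0%R, 1%R] <= leb N)%E.
  by apply: le_measure; rewrite ?inE// NT.
rewrite N0 lebesgue_measure_itv/= lte_fin ltr01 sube0.
by rewrite lee_fin leNgt ltr01.
Qed.

Lemma measurable_inv_oneDsqr : measurable_fun setT (fun t : R => (1 + t ^+ 2)^-1).
Proof.
by apply: continuous_measurable_fun; exact: continuous_oneDsqrV.
Qed.

Lemma integral_inv_oneDsqr : (\int[leb]_t ((1 + t ^+ 2)^-1)%:E = pi%:E)%E.
Proof.
rewrite ge0_symfun_integralT/=.
- transitivity (2%:E * (pi / 2 : R)%:E)%E; last by rewrite -EFinM; congr EFin; field.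
  congr (_ * _)%E; rewrite -integral0y_oneDsqr.
  by congr integral; apply/seteqP; split=> t /=; rewrite in_itv/= andbT.
- by move=> x; rewrite invr_ge0 addr_ge0// sqr_ge0.
- exact: continuous_oneDsqrV.
- by move=> x /=; rewrite sqrrN.
Qed.

Lemma measurable_fun_posV d (T : measurableType d) (f : T -> R) :
  (forall x, 0 < f x) -> measurable_fun setT f ->
  measurable_fun setT (fun x => (f x)^-1).
Proof.
move=> f0 mf; rewrite (_ : (fun _ => _) = (fun x => expR (- ln (f x)))); last first.
  by apply/funext => x; rewrite expRN lnK// posrE.
apply: (measurableT_comp (@measurable_expR R)).
apply: measurable_funN; exact: (measurableT_comp (@measurable_ln R)).
Qed.
End integral_facts.

(** * Iterated integrals on R^n *)

Section rvint_facts.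
Variable R : realType.
Local Notation leb := (@lebesgue_measure R).

(* Joint measurability on T x R^n, tested on all measurable maps into T x R^n
   given by their coordinates; no sigma-algebra on 'rV[R]_n is needed. *)
Definition rvmeas d (T : measurableType d) n (F : T -> 'rV[R]_n -> \bar R) :=
  forall d' (T' : measurableType d') (g : T' -> T) (c : 'I_n -> T' -> R),
    measurable_fun setT g -> (forall i, measurable_fun setT (c i)) ->
    measurable_fun setT (fun x => F (g x) (\row_i c i x)).

(** Spelled like the vector in the recursion of [rvint], so that the two agree by conversion. *)
Definition row_cons n (s : R) (v : 'rV[R]_n) : 'rV[R]_n.+1 :=
  row_mx (\row_(j < 1) s) v.

Lemma row_cons_0 n s (v : 'rV[R]_n) : row_cons s v 0 0 = s.
Proof.
have -> : (0 : 'I_n.+1) = lshift n (0 : 'I_1) by exact: val_inj.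
by have := row_mxEl (\row_(j < 1) s) v 0 (0 : 'I_1); rewrite mxE.
Qed.

Lemma row_cons_lift n s (v : 'rV[R]_n) i : row_cons s v 0 (lift ord0 i) = v 0 i.
Proof.
have -> : lift ord0 i = rshift 1 i by exact: val_inj.
exact: row_mxEr (\row_(j < 1) s) v 0 i.
Qed.

Lemma row_cons_row n (s : R) (c : 'I_n -> R) :
  row_cons s (\row_i c i) = \row_i (if unlift ord0 i is Some j then c j else s).
Proof.
apply/rowP => i; rewrite mxE; case: unliftP => [j ->|->].
  by rewrite row_cons_lift mxE.
by rewrite row_cons_0.
Qed.

(** Moving the first coordinate to the parameter side is what lets inductions on the dimension go
    through. *)
Lemma rvmeas_row_cons d (T : measurableType d) n (F : T -> 'rV[R]_n.+1 -> \bar R) :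
  rvmeas F -> @rvmeas _ (T * R)%type n (fun ts v => F ts.1 (row_cons ts.2 v)).
Proof.
move=> mF d' T' g c mg mc.
have [mg1 mg2] := (measurable_fun_pairP g).1 mg.
under eq_fun do rewrite row_cons_row.
apply: (mF _ _ _ (fun i x => if unlift ord0 i is Some j then c j x else (g x).2)) => //.
by move=> i; case: unlift.
Qed.

Lemma rvmeas_comp d (T : measurableType d) d1 (T1 : measurableType d1) n
    (F : T -> 'rV[R]_n -> \bar R) (h : T1 -> T) :
  measurable_fun setT h -> rvmeas F -> rvmeas (fun x => F (h x)).
Proof.
move=> mh mF d' T' g c mg mc; apply: (mF _ _ (h \o g)) => //.
exact: measurableT_comp.
Qed.

Lemma rvmeas_fst d (T : measurableType d) n (F : T -> 'rV[R]_n -> \bar R) v :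
  rvmeas F -> measurable_fun setT (F ^~ v).
Proof.
move=> mF; rewrite (_ : F ^~ v = fun x => F (id x) (\row_i v 0 i)); last first.
  by apply/funext => x; congr (F x _); apply/rowP => i; rewrite mxE.
apply: (mF _ _ id (fun i _ => v 0 i)); first exact: measurable_id.
by move=> i; exact: measurable_cst.
Qed.

Lemma measurable_integral_snd d (T : measurableType d) (f : T * R -> \bar R) :
  measurable_fun setT f -> (forall x, 0 <= f x)%E ->
  measurable_fun setT (fun x => \int[leb]_s f (x, s))%E.
Proof. by move=> mf f0; exact: (measurable_fun_fubini_tonelli_F (m2 := leb) f). Qed.

Lemma rvint_ge0 n (f : 'rV[R]_n -> \bar R) : (forall v, 0 <= f v)%E -> (0 <= rvint f)%E.
Proof.
elim: n f => [|n IH] f f0 //=.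
by apply: integral_ge0 => t _; exact: IH.
Qed.

Lemma le_rvint n (f g : 'rV[R]_n -> \bar R) :
  (forall v, 0 <= f v)%E -> (forall v, f v <= g v)%E -> (rvint f <= rvint g)%E.
Proof.
elim: n f g => [|n IH] f g f0 fg //=.
by apply: ge0_le_integralT => t; [exact: rvint_ge0|exact: IH].
Qed.

Lemma eq_rvint n (f g : 'rV[R]_n -> \bar R) : f =1 g -> rvint f = rvint g.
Proof. by move=> fg; congr rvint; apply/funext. Qed.

(** Induction on [n] for all parameter spaces at once: the outermost coordinate joins the parameter,
    and Tonelli integrates it out. *)
Lemma measurable_rvint d (T : measurableType d) n (F : T -> 'rV[R]_n -> \bar R) :
  rvmeas F -> (forall t v, 0 <= F t v)%E ->
  measurable_fun setT (fun t => rvint (F t)).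
Proof.
elim: n d T F => [|n IH] d T F mF F0 /=; first exact: rvmeas_fst.
apply: (@measurable_integral_snd _ _ (fun ts => rvint (fun v => F ts.1 (row_cons ts.2 v)))).
  by apply: IH => //; exact: rvmeas_row_cons.
by move=> ts; exact: rvint_ge0.
Qed.

Lemma rvmeas_slice d (T : measurableType d) n (F : T -> 'rV[R]_n -> \bar R) t :
  rvmeas F -> rvmeas (fun _ : unit => F t).
Proof. by apply: rvmeas_comp; exact: measurable_cst. Qed.

(** The integral over [t] is exchanged with the outermost coordinate by Tonelli, then with the
    others by induction. *)
Lemma tonelli_rvint n (F : R -> 'rV[R]_n -> \bar R) :
  rvmeas F -> (forall t v, 0 <= F t v)%E ->
  (\int[leb]_t rvint (F t) = rvint (fun v => \int[leb]_t F t v))%E.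
Proof.
elim: n F => [|n IH] F mF F0 //=.
have mF1 := rvmeas_row_cons mF.
transitivity (\int[leb]_s \int[leb]_t rvint (fun v => F t (row_cons s v)))%E.
  apply: (fubini_tonelli (m1 := leb) (m2 := leb)
    (fun ts : R * R => rvint (fun v => F ts.1 (row_cons ts.2 v)))).
    exact: measurable_rvint.
  by move=> ts; exact: rvint_ge0.
apply: eq_integral => s _ /=; apply: (IH (fun t v => F t (row_cons s v))) => //.
apply: (rvmeas_comp (h := fun t => (t, s)) _ mF1).
by apply: measurable_fun_pair; [exact: measurable_id|exact: measurable_cst].
Qed.

Lemma rvintZl n (F : 'rV[R]_n -> \bar R) (k : R) :
  rvmeas (fun _ : unit => F) -> (forall v, 0 <= F v)%E -> 0 <= k ->
  (rvint (fun v => k%:E * F v) = k%:E * rvint F)%E.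
Proof.
elim: n F => [|n IH] F mF F0 k0 //=.
have mF1 := rvmeas_row_cons mF.
rewrite -ge0_integralZl_EFin//.
- apply: eq_integral => s _; apply: (IH (fun v => F (row_cons s v))) => //.
  by apply: (rvmeas_comp (h := fun _ : unit => (tt, s)) _ mF1); exact: measurable_cst.
- by move=> s _; exact: rvint_ge0.
- apply: (@measurable_rvint _ _ _ (fun s v => F (row_cons s v))) => //.
  apply: (rvmeas_comp (h := fun s : R => (tt, s)) _ mF1).
  by apply: measurable_fun_pair; [exact: measurable_cst|exact: measurable_id].
Qed.

Lemma rvint_prod n (f : R -> R) (I : R) :
  measurable_fun setT f -> (forall t, 0 <= f t) ->
  (\int[leb]_t (f t)%:E = I%:E)%E ->
  rvint (fun v : 'rV[R]_n => (\prod_(i < n) f (v 0 i))%:E) = (I ^+ n)%:E.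
Proof.
move=> mf f0 fI.
have I0 : 0 <= I by rewrite -lee_fin -fI; apply: integral_ge0 => t _; rewrite lee_fin.
elim: n => [|n IH] /=; first by rewrite big_ord0.
transitivity (\int[leb]_t ((I ^+ n)%:E * (f t)%:E))%E; last first.
  rewrite ge0_integralZl_EFin ?exprn_ge0//.
  - by rewrite fI -EFinM exprSr.
  - by move=> t _; rewrite lee_fin.
  - exact/measurable_EFinP.
apply: eq_integral => t _; rewrite -IH muleC -rvintZl//.
- apply: eq_rvint => v; rewrite -EFinM big_ord_recl row_cons_0; congr (_ * _)%:E.
  by apply: eq_bigr => i _; rewrite row_cons_lift.
- move=> d' T' g c mg mc; apply/measurable_EFinP.
  under eq_fun do under eq_bigr do rewrite mxE.
  apply: measurable_prod => i _; exact: measurableT_comp.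
- by move=> v; rewrite lee_fin prodr_ge0.
Qed.
End rvint_facts.

(** * Two-block Gibbs samplers *)

Section gibbs_facts.
Variables (R : realType) (p : nat) (dens : 'rV[R]_p -> R -> R).
Local Notation leb := (@lebesgue_measure R).
(** Real-valued normalizing constants of the two full conditionals; [z] is also the unnormalised
    marginal posterior density of Theta. *)
Variables (z : R -> R) (w : 'rV[R]_p -> R).
Hypothesis dens_ge0 : forall u t, 0 <= dens u t.
Hypothesis mdens : rvmeas (fun t u => (dens u t)%:E).
Hypothesis z_gt0 : forall t, 0 < z t.
Hypothesis zE : forall t, rvint (fun u => (dens u t)%:E) = (z t)%:E.
Hypothesis w_gt0 : forall u, 0 < w u.
Hypothesis wE : forall u, (\int[leb]_t (dens u t)%:E = (w u)%:E)%E.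

Let K := trans_dens dens.
Let k (x : R * R) u := dens u x.1 / z x.1 * (dens u x.2 / w u).

Let z_ge0 t : 0 <= z t. Proof. exact: ltW. Qed.
Let w_ge0 u : 0 <= w u. Proof. exact: ltW. Qed.

Let k_ge0 x u : 0 <= k x u.
Proof. by rewrite /k mulr_ge0// divr_ge0. Qed.

Lemma condUE t u : condU dens t u = (dens u t / z t)%:E.
Proof. by rewrite /condU zE inver gt_eqF// -EFinM. Qed.

Lemma condThetaE t u : condTheta dens u t = (dens u t / w u)%:E.
Proof. by rewrite /condTheta wE inver gt_eqF// -EFinM. Qed.

Lemma trans_densE s t : K s t = rvint (fun u => (k (s, t) u)%:E).
Proof.
by apply: eq_rvint => u; rewrite condUE condThetaE -EFinM.
Qed.

Lemma measurable_normalizer : measurable_fun setT z.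
Proof.
apply/measurable_EFinP; rewrite (_ : _ \o _ = fun t => rvint (fun u => (dens u t)%:E)).
  by apply: (measurable_rvint mdens) => t v; rewrite lee_fin.
by apply/funext => t /=; rewrite zE.
Qed.

Lemma measurable_dens d (T : measurableType d) (g : T -> R) (c : 'I_p -> T -> R) :
  measurable_fun setT g -> (forall i, measurable_fun setT (c i)) ->
  measurable_fun setT (fun x => dens (\row_i c i x) (g x)).
Proof. by move=> mg mc; apply/measurable_EFinP; exact: mdens mg mc. Qed.

Lemma measurable_thnormalizer d (T : measurableType d) (c : 'I_p -> T -> R) :
  (forall i, measurable_fun setT (c i)) ->
  measurable_fun setT (fun x => w (\row_i c i x)).
Proof.
move=> mc; apply/measurable_EFinP.
rewrite (_ : _ \o _ = fun x => \int[leb]_t (dens (\row_i c i x) t)%:E)%E; last first.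
  by apply/funext => x /=; rewrite wE.
apply: (measurable_integral_snd (f := fun xt : T * R => (dens (\row_i c i xt.1) xt.2)%:E)).
  apply/measurable_EFinP.
  apply: (measurable_dens (c := fun i (x : T * R) => c i x.1)) => // i.
  exact: measurableT_comp.
by move=> x; rewrite lee_fin.
Qed.

Lemma rvmeas_k : @rvmeas R _ (R * R)%type p (fun x u => (k x u)%:E).
Proof.
move=> d T g c mg mc; have [mg1 mg2] := (measurable_fun_pairP g).1 mg.
apply/measurable_EFinP; apply: measurable_funM; apply: measurable_funM.
- exact: measurable_dens.
- apply: measurable_fun_posV => //.
  by apply: measurableT_comp mg1; exact: measurable_normalizer.
- exact: measurable_dens.
- by apply: measurable_fun_posV => //; exact: measurable_thnormalizer.
Qed.

Lemma trans_dens_ge0 s t : (0 <= K s t)%E.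
Proof. by rewrite trans_densE; apply: rvint_ge0 => u; rewrite lee_fin. Qed.

Lemma measurable_trans_dens : measurable_fun setT (fun x : R * R => K x.1 x.2).
Proof.
rewrite (_ : (fun _ => _) = fun x => rvint (fun u => (k x u)%:E)).
  by apply: (measurable_rvint rvmeas_k) => x u; rewrite lee_fin.
by apply/funext => -[s t]; rewrite trans_densE.
Qed.

Lemma measurable_trans_dens1 s : measurable_fun setT (K s).
Proof.
apply: (measurableT_comp (f := fun x : R * R => K x.1 x.2) (g := pair s)).
  exact: measurable_trans_dens.
by apply: measurable_fun_pair => //; exact: measurable_cst.
Qed.

(** After multiplication by [z s] the integrand becomes d(u, s) d(u, t) / w(u), which is symmetric
    in [s] and [t]. *)
Lemma trans_dens_reversible s t : ((z s)%:E * K s t = (z t)%:E * K t s)%E.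
Proof.
rewrite !trans_densE -!rvintZl//; try by move=> v; rewrite lee_fin.
- apply: eq_rvint => u; rewrite -!EFinM /k/=; congr EFin.
  by field; rewrite !gt_eqF.
- exact: rvmeas_slice rvmeas_k.
- exact: rvmeas_slice rvmeas_k.
Qed.

(** Conditioning on the latent draw: the mean of [f] after one step is the average over u, given
    [s], of the mean of [f] given u. *)
Lemma integral_trans_dens (f : R -> R) s :
  measurable_fun setT f -> (forall t, 0 <= f t) ->
  (\int[leb]_t (K s t * (f t)%:E) =
   rvint (fun u => (dens u s / z s)%:E * ((w u)^-1%:E * \int[leb]_t (dens u t * f t)%:E)))%E.
Proof.
move=> mf f0.
transitivity (\int[leb]_t rvint (fun u => (f t * k (s, t) u)%:E))%E.
  apply: eq_integral => t _; rewrite muleC trans_densE -rvintZl//.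
    exact: rvmeas_slice rvmeas_k.
  by move=> u; rewrite lee_fin.
have mfk : rvmeas (fun t u => (f t * k (s, t) u)%:E).
  move=> d T g c mg mc; apply/measurable_EFinP/measurable_funM.
    exact: measurableT_comp.
  apply/measurable_EFinP; apply: (rvmeas_k (g := fun x => (s, g x))) => //.
  by apply: measurable_fun_pair => //; exact: measurable_cst.
rewrite tonelli_rvint//; last by move=> t u; rewrite lee_fin mulr_ge0.
apply: eq_rvint => u; rewrite muleA -EFinM -ge0_integralZl_EFin//.
- by apply: eq_integral => t _; rewrite -EFinM; congr EFin; rewrite /k/=; ring.
- by move=> t _; rewrite lee_fin mulr_ge0.
- apply/measurable_EFinP/measurable_funM => //.
  by apply/measurable_EFinP; exact: rvmeas_fst mdens.
- by rewrite mulr_ge0 ?divr_ge0 ?invr_ge0.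
Qed.

Lemma trans_dens_prob s : (\int[leb]_t K s t = 1)%E.
Proof.
transitivity (\int[leb]_t (K s t * (cst 1 t)%:E))%E.
  by apply: eq_integral => t _; rewrite mule1.
rewrite integral_trans_dens//.
transitivity (rvint (fun u => (z s)^-1%:E * (dens u s)%:E))%E.
  apply: eq_rvint => u; under eq_integral do rewrite /cst mulr1.
  by rewrite wE -!EFinM; congr EFin; field; rewrite !gt_eqF.
rewrite rvintZl//.
- by rewrite zE -EFinM mulVf// gt_eqF.
- exact: rvmeas_slice mdens.
- by move=> v; rewrite lee_fin.
- by rewrite invr_ge0.
Qed.

Section measurable_event.
Variable A : set R.
Hypothesis mA : measurable A.

(** The two claims share one induction because measurability of the next integral uses nonnegativity
    of the previous step. *)
Lemma nstep_measurable_prob n : measurable_fun setT (fun t => nstep dens n t A) /\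
  (forall t, 0 <= nstep dens n t A <= 1)%E.
Proof.
elim: n => [|n [mh h01]].
  split; first by apply/measurable_EFinP; exact: measurable_indic.
  by move=> t /=; rewrite indicE lee_fin ler0n lee_fin lern1 leq_b1.
have h0 t : (0 <= nstep dens n t A)%E by have /andP[] := h01 t.
split => [|t] /=.
  apply: (measurable_integral_snd (f := fun x : R * R => K x.1 x.2 * nstep dens n x.2 A)%E).
    apply: emeasurable_funM; first exact: measurable_trans_dens.
    exact: (measurableT_comp mh measurable_snd).
  by move=> x; rewrite mule_ge0// trans_dens_ge0.
apply/andP; split; first by apply: integral_ge0 => s _; rewrite mule_ge0// trans_dens_ge0.
rewrite -(trans_dens_prob t); apply: ge0_le_integralT => s.
  by rewrite mule_ge0// trans_dens_ge0.
rewrite -[leRHS]mule1; apply: lee_wpmul2l; first exact: trans_dens_ge0.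
by have /andP[] := h01 s.
Qed.

Lemma measurable_nstep n : measurable_fun setT (fun t => nstep dens n t A).
Proof. by have [] := nstep_measurable_prob n. Qed.

Lemma nstep_ge0 n t : (0 <= nstep dens n t A)%E.
Proof. by have [_ /(_ t)/andP[]] := nstep_measurable_prob n. Qed.

Lemma nstep_le1 n t : (nstep dens n t A <= 1)%E.
Proof. by have [_ /(_ t)/andP[]] := nstep_measurable_prob n. Qed.

Lemma nstep_fin n t : nstep dens n t A = (fine (nstep dens n t A))%:E.
Proof.
rewrite fineK// ge0_fin_numE ?nstep_ge0//.
by rewrite (le_lt_trans (nstep_le1 n t))// ltry.
Qed.

(* Stationarity, from reversibility of the kernel. *)
Lemma integral_nstep n :
  (\int[leb]_t ((z t)%:E * nstep dens n t A) = \int[leb]_(t in A) (z t)%:E)%E.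
Proof.
elim: n => [|n IH] /=.
  rewrite [RHS]integral_mkcond; apply: eq_integral => t _.
  by rewrite patchE indicE; case: ifP => _; rewrite ?mule1 ?mule0.
rewrite -IH.
transitivity (\int[leb]_s \int[leb]_t ((z s)%:E * (K s t * nstep dens n t A)))%E.
  apply: eq_integral => s _; rewrite ge0_integralZl_EFin//.
  - by move=> t _; rewrite mule_ge0 ?trans_dens_ge0 ?nstep_ge0.
  - apply: emeasurable_funM; first exact: measurable_trans_dens1.
    exact: measurable_nstep.
transitivity (\int[leb]_t \int[leb]_s ((z s)%:E * (K s t * nstep dens n t A)))%E.
  apply: (fubini_tonelli (m1 := leb) (m2 := leb)
    (fun x : R * R => (z x.1)%:E * (K x.1 x.2 * nstep dens n x.2 A))%E).
    apply: emeasurable_funM.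
      apply/measurable_EFinP; exact: (measurableT_comp measurable_normalizer measurable_fst).
    apply: emeasurable_funM; first exact: measurable_trans_dens.
    exact: (measurableT_comp (measurable_nstep n) measurable_snd).
  by move=> x; rewrite !mule_ge0 ?lee_fin ?trans_dens_ge0 ?nstep_ge0.
apply: eq_integral => t _.
(* Reversibility takes [z t] and the n-step probability out of the inner integral; what remains is
   the total mass of [K t], which is 1. *)
transitivity (\int[leb]_s (((z t)%:E * nstep dens n t A) * K t s))%E.
  by apply: eq_integral => s _; rewrite muleA trans_dens_reversible muleAC.
rewrite ge0_integralZl ?trans_dens_prob ?mule1//.
- exact: measurable_trans_dens1.
- by move=> s _; exact: trans_dens_ge0.
- by rewrite mule_ge0 ?lee_fin ?nstep_ge0.
Qed.

(** * Contraction under Doeblin's minorization condition *)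

Section doeblin.
Variables (g : R -> R) (eps : R).
Hypothesis mg : measurable_fun setT g.
Hypothesis g_ge0 : forall t, 0 <= g t.
Hypothesis gE : (\int[leb]_t (g t)%:E = eps%:E)%E.
Hypothesis gK : forall s t, ((g t)%:E <= K s t)%E.

Lemma minorization_le1 : eps <= 1.
Proof.
by rewrite -lee_fin -gE -(trans_dens_prob 0); apply: ge0_le_integralT.
Qed.

(** The common part [g] of all the kernels averages the n-step probability in the same way from
    every state, so only the remaining mass 1 - eps carries the oscillation over. *)
Lemma oscillation_nstep n : exists a b : R, [/\ 0 <= a, a <= b, b - a <= (1 - eps) ^+ n &
  forall t, (a%:E <= nstep dens n t A <= b%:E)%E].
Proof.
elim: n => [|n [a [b [a0 ab abn hab]]]].
  exists 0, 1; split => //; first by rewrite subr0 expr0.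
  by move=> t; rewrite nstep_ge0 nstep_le1.
pose h t := fine (nstep dens n t A).
have hE t : nstep dens n t A = (h t)%:E by exact: nstep_fin.
have mh : measurable_fun setT h.
  by apply/measurable_EFinP; apply: eq_measurable_fun (measurable_nstep n) => t _; rewrite hE.
have ah t : 0 <= h t - a by rewrite subr_ge0 -lee_fin -hE; have /andP[] := hab t.
have hb t : 0 <= b - h t by rewrite subr_ge0 -lee_fin -hE; have /andP[] := hab t.
have h0 t : 0 <= h t by rewrite -lee_fin -hE nstep_ge0.
have b0 : 0 <= b by exact: le_trans ab.
have ba0 : 0 <= b - a by rewrite subr_ge0.
have mha : measurable_fun setT (fun t => h t - a) by exact: measurable_funB.
have mbh : measurable_fun setT (fun t => b - h t) by exact: measurable_funB.
(* The amounts by which the lower bound rises and the upper bound drops; their sum is (b - a)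
   eps. *)
pose I := (\int[leb]_t (g t * (h t - a))%:E)%E.
pose J := (\int[leb]_t (g t * (b - h t))%:E)%E.
have I0 : (0 <= I)%E by apply: integral_ge0 => t _; rewrite lee_fin mulr_ge0.
have J0 : (0 <= J)%E by apply: integral_ge0 => t _; rewrite lee_fin mulr_ge0.
have IJ : (I + J = ((b - a) * eps)%:E)%E.
  rewrite EFinM -gE -ge0_integralZl_EFin//; last 2 first.
    by move=> t _; rewrite lee_fin.
    exact/measurable_EFinP.
  rewrite -ge0_integralD//.
  - by apply: eq_integral => t _; rewrite -EFinD -EFinM; congr EFin; ring.
  - by move=> t _; rewrite lee_fin mulr_ge0.
  - exact/measurable_EFinP/measurable_funM.
  - by move=> t _; rewrite lee_fin mulr_ge0.
  - exact/measurable_EFinP/measurable_funM.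
have Ifin : I \is a fin_num.
  by rewrite ge0_fin_numE// (@le_lt_trans _ _ (I + J)%E) ?leeDl// IJ ltry.
have Jfin : J \is a fin_num.
  by rewrite ge0_fin_numE// (@le_lt_trans _ _ (I + J)%E) ?leeDr// IJ ltry.
have mKf (f : R -> R) s : measurable_fun setT f ->
    measurable_fun setT (fun t => K s t * (f t)%:E)%E.
  move=> mf; apply: emeasurable_funM; first exact: measurable_trans_dens1.
  exact/measurable_EFinP.
have Kf0 (f : R -> R) s t : (forall t, 0 <= f t) -> (0 <= K s t * (f t)%:E)%E.
  by move=> f0; rewrite mule_ge0 ?trans_dens_ge0 ?lee_fin.
have Kcst s (c : R) : 0 <= c -> (\int[leb]_t (K s t * c%:E) = c%:E)%E.
  move=> c0; under eq_integral do rewrite muleC.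
  rewrite ge0_integralZl_EFin// ?trans_dens_prob ?mule1//.
    by move=> t _; exact: trans_dens_ge0.
  exact: measurable_trans_dens1.
exists (a + fine I), (b - fine J); split.
- by rewrite addr_ge0// fine_ge0.
- have : (fine I + fine J <= b - a).
    rewrite -lee_fin EFinD !fineK// IJ lee_fin.
    by rewrite -[leRHS]mulr1 ler_wpM2l// minorization_le1.
  lra.
- have -> : b - fine J - (a + fine I) = (b - a) * (1 - eps).
    have : fine I + fine J = (b - a) * eps by apply: EFin_inj; rewrite EFinD !fineK.
    lra.
  by rewrite exprSr ler_wpM2r// subr_ge0 minorization_le1.
(* Lower bound: write [h] as [a] plus the nonnegative [h - a], and use [K >= g] on the latter. The
   upper bound is symmetric, with [b - h]. *)
move=> s /=; apply/andP; split.
- rewrite EFinD fineK// addeC -[a%:E in leLHS](Kcst s a)//.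
  apply: (@le_trans _ _ (\int[leb]_t (K s t * (h t - a)%:E) + \int[leb]_t (K s t * a%:E))%E).
    apply: leeD => //; apply: ge0_le_integralT => t; first by rewrite lee_fin mulr_ge0.
    by rewrite EFinM; apply: lee_wpmul2r; [rewrite lee_fin|exact: gK].
  rewrite -ge0_integralD//; first last.
  - by apply: mKf; exact: measurable_cst.
  - by move=> t _; apply: (Kf0 (cst a)).
  - exact: mKf.
  - by move=> t _; apply: (Kf0 (fun t => h t - a)).
  apply: ge0_le_integralT => t.
    by rewrite adde_ge0//; [exact: (Kf0 (fun t => h t - a))|exact: (Kf0 (cst a))].
  by rewrite -ge0_muleDr ?lee_fin// -EFinD subrK hE.
- rewrite EFinB fineK// leeBrDr//.
  rewrite -[leRHS](Kcst s b)//.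
  apply: (@le_trans _ _ (\int[leb]_t (K s t * (h t)%:E) + \int[leb]_t (K s t * (b - h t)%:E))%E).
    apply: leeD; first by apply: ge0_le_integralT => t; rewrite hE //; exact: (Kf0 h).
    apply: ge0_le_integralT => t; first by rewrite lee_fin mulr_ge0.
    by rewrite EFinM; apply: lee_wpmul2r; [rewrite lee_fin|exact: gK].
  rewrite -ge0_integralD//; first last.
  - exact: mKf.
  - by move=> t _; apply: (Kf0 (fun t => b - h t)).
  - exact: mKf.
  - by move=> t _; apply: (Kf0 h).
  apply: ge0_le_integralT => t.
    by rewrite adde_ge0//; [exact: (Kf0 h)|exact: (Kf0 (fun t => b - h t))].
  by rewrite -ge0_muleDr ?lee_fin// -EFinD addrC subrK.
Qed.
End doeblin.
End measurable_event.

(** * Uniform ergodicity from minorization, and exponential tails *)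

Variable m : R.
Hypothesis m_gt0 : 0 < m.
Hypothesis mE : (\int[leb]_t (z t)%:E = m%:E)%E.

Lemma post_ThetaE A : post_Theta dens A = ((\int[leb]_(t in A) (z t)%:E) * m^-1%:E)%E.
Proof.
rewrite /post_Theta; under eq_integral do rewrite zE.
by under [in X in (_ / X)%E]eq_integral do rewrite zE; rewrite mE inver gt_eqF.
Qed.

(** By stationarity the posterior probability of an event is a weighted average of its n-step
    probabilities, so both lie in one interval of length at most (1 - eps)^n. *)
Theorem uniformly_ergodic_minorization (g : R -> R) (eps : R) :
  measurable_fun setT g -> (forall t, 0 <= g t) ->
  (\int[leb]_t (g t)%:E = eps%:E)%E -> 0 < eps ->
  (forall s t, ((g t)%:E <= K s t)%E) -> uniformly_ergodic dens.
Proof.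
move=> mg g0 gE eps0 gK; have eps1 := minorization_le1 g0 gE gK.
exists (1 - eps), (cst 1); split; first by apply/andP; split; lra.
split; first by exists 1.
move=> t n; rewrite /cst mul1r; apply: ge_ereal_sup => _ /= [A mA <-].
have [a [b [a0 ab abn hab]]] := oscillation_nstep mA mg g0 gE gK n.
have mz := measurable_normalizer.
have h0 s := nstep_ge0 mA n s.
have cz (c : R) : 0 <= c -> (\int[leb]_t (c * z t)%:E = c%:E * m%:E)%E.
  move=> c0; rewrite -mE -ge0_integralZl_EFin//.
    by move=> x _; rewrite lee_fin.
  exact/measurable_EFinP.
have La : (a%:E <= post_Theta dens A)%E.
  rewrite post_ThetaE lee_pdivlMr// -cz// -(integral_nstep mA n).
  apply: ge0_le_integralT => x; first by rewrite lee_fin mulr_ge0.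
  rewrite EFinM muleC; apply: lee_wpmul2l; rewrite ?lee_fin//.
  by have /andP[] := hab x.
have Lb : (post_Theta dens A <= b%:E)%E.
  rewrite post_ThetaE lee_pdivrMr// -cz ?(le_trans a0 ab)// -(integral_nstep mA n).
  apply: ge0_le_integralT => x; first by rewrite mule_ge0 ?lee_fin.
  rewrite EFinM muleC; apply: lee_wpmul2r; rewrite ?lee_fin//.
  by have /andP[] := hab x.
have Pfin : post_Theta dens A \is a fin_num.
  by rewrite fin_numElt (lt_le_trans _ La) ?ltNyr//= (le_lt_trans Lb) ?ltry.
have /andP[] := hab t.
move: La Lb; rewrite -(fineK Pfin) (nstep_fin mA) -EFinB !lee_fin => La Lb ha hb.
rewrite (le_trans _ abn)// ler_norml; apply/andP; split; lra.
Qed.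

(** Markov's inequality for the exponential, iterated: each step multiplies the mean of exp by at
    most [C]. At [n = 0] the indicator of s > T is below exp(s - T). *)
Lemma nstep_exp_tail (C : R) : 0 <= C ->
  (forall s, \int[leb]_t (K s t * (expR t)%:E) <= (C * expR s)%:E)%E ->
  forall n s T, (nstep dens n s `]T, +oo[ <= (C ^+ n * expR (s - T))%:E)%E.
Proof.
move=> C0 KC; elim=> [|n IH] s T /=.
  rewrite lee_fin expr0 mul1r indicE.
  case: (boolP (s \in _)) => [|_]; last by rewrite expR_ge0.
  rewrite inE/= in_itv/= andbT => Ts.
  by rewrite (le_trans _ (expR_ge1Dx _))// lerDl subr_ge0 ltW.
apply: (@le_trans _ _ (\int[leb]_t ((C ^+ n * expR (- T))%:E * (K s t * (expR t)%:E)))%E).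
  apply: ge0_le_integralT => t.
    by rewrite mule_ge0 ?trans_dens_ge0 ?nstep_ge0.
  rewrite muleCA; apply: lee_wpmul2l; first exact: trans_dens_ge0.
  by rewrite -EFinM -mulrA -expRD (addrC (- T)) IH.
rewrite ge0_integralZl_EFin ?mulr_ge0 ?exprn_ge0 ?expR_ge0//.
- apply: (@le_trans _ _ ((C ^+ n * expR (- T))%:E * (C * expR s)%:E)%E).
    by apply: lee_wpmul2l; rewrite ?KC// lee_fin mulr_ge0 ?exprn_ge0 ?expR_ge0.
  by rewrite -EFinM lee_fin expRD exprS -subr_ge0 le_eqVlt; apply/orP; left; apply/eqP; ring.
- by move=> t _; rewrite mule_ge0 ?trans_dens_ge0 ?lee_fin ?expR_ge0.
- apply: emeasurable_funM; first exact: measurable_trans_dens1.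
  by apply/measurable_EFinP; exact: measurable_expR.
Qed.
End gibbs_facts.

(** * Positive definite quadratic forms *)

Section bform_facts.
Variables (R : comNzRingType) (p : nat) (A : 'M[R]_p).

Definition bform (u v : 'rV[R]_p) : R := (u *m A *m v^T) 0 0.

Lemma bformBl u1 u2 v : bform (u1 - u2) v = bform u1 v - bform u2 v.
Proof. by rewrite /bform !mulmxBl [LHS]mxE [X in _ + X]mxE. Qed.

Lemma bformBr u v1 v2 : bform u (v1 - v2) = bform u v1 - bform u v2.
Proof. by rewrite /bform linearB/= mulmxBr [LHS]mxE [X in _ + X]mxE. Qed.

Lemma bformZl a u v : bform (a *: u) v = a * bform u v.
Proof. by rewrite /bform -!scalemxAl [LHS]mxE. Qed.

Lemma bformZr a u v : bform u (a *: v) = a * bform u v.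
Proof. by rewrite /bform linearZ/= -scalemxAr [LHS]mxE. Qed.

(** A 1 by 1 matrix is its own trace, and the trace is invariant under transposition. *)
Lemma bformC u v : A^T = A -> bform u v = bform v u.
Proof.
by move=> sA; rewrite /bform -[LHS]trace_mx11 -mxtrace_tr !trmx_mul trmxK sA mulmxA trace_mx11.
Qed.

Lemma bform_sum u v : bform u v = \sum_i \sum_j u 0 i * A i j * v 0 j.
Proof.
rewrite /bform mxE exchange_big; apply: eq_bigr => j _.
by rewrite !mxE mulr_suml; apply: eq_bigr => i _.
Qed.
End bform_facts.

(** * Positive definite matrices: determinant and inverse *)

Section posdef_facts.
Variables (R : realType) (p : nat) (S : 'M[R]_p).

Lemma posdef_det_neq0 (A : 'M[R]_p) : posdef A -> \det A != 0.
Proof.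
move=> [_ A0]; apply/negP => /det0P [v v0 vA].
by have := A0 v v0; rewrite vA mul0mx mxE ltxx.
Qed.

Hypothesis pS : posdef S.

(* The determinant does not vanish on the segment from the identity to S. *)
Lemma posdef_det_gt0 : 0 < \det S.
Proof.
(* As a polynomial in t this is det(t S + (1 - t) I), with value 1 at 0 and det S at 1. If det S <=
   0 it has a root in [0, 1], yet every matrix on the segment is positive definite. *)
pose P : {poly R} := \det ('X *: map_mx polyC S + (1 - 'X)%:M).
have PE t : P.[t] = \det (t *: S + (1 - t)%:M).
  rewrite -[LHS]/(horner_eval t P) -det_map_mx; congr determinant.
  apply/matrixP => i j; rewrite !mxE /= /horner_eval hornerD hornerM hornerX hornerC.
  by case: (i == j); rewrite ?mulr1n ?mulr0n ?horner0 ?hornerD ?hornerN ?hornerX ?hornerC.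
have Pneq t : 0 <= t <= 1 -> P.[t] != 0.
  move=> /andP[t0 t1]; rewrite PE; apply: posdef_det_neq0.
  case: pS => St S0; split; first by rewrite linearD linearZ/= St tr_scalar_mx.
  move=> v v0; rewrite mulmxDr mulmxDl mxE -scalemxAr -scalemxAl mxE.
  rewrite mul_mx_scalar -scalemxAl [X in _ + X]mxE.
  have vv : 0 < (v *m v^T) 0 0.
    have /rV0Pn[i vi] := v0.
    rewrite mxE (bigD1 i)//= ltr_wpDr//; first by apply: sumr_ge0 => j _; rewrite mxE -expr2 sqr_ge0.
    by rewrite mxE -expr2 lt0r sqrf_eq0 vi sqr_ge0.
  have [->|tn0] := eqVneq t 0; first by rewrite mul0r add0r subr0 mul1r.
  by rewrite ltr_wpDr ?mulr_ge0 ?subr_ge0 ?(ltW vv)// mulr_gt0 ?S0// lt0r tn0.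
have P0 : P.[0] = 1 by rewrite PE scale0r add0r subr0 det1.
have P1 : P.[1] = \det S by rewrite PE scale1r subrr raddf0 addr0.
rewrite ltNge; apply/negP => S0.
have [|t t01] := @poly_ivt R (- P) 0 1 ler01.
  by rewrite !hornerN P0 P1 oppr_le0 ler01/= oppr_ge0.
by rewrite /root hornerN oppr_eq0 (negbTE (Pneq t t01)).
Qed.

Lemma posdef_unit : S \in unitmx.
Proof. by rewrite unitmxE unitfE gt_eqF// posdef_det_gt0. Qed.

Lemma posdef_ge0 v : 0 <= bform S v v.
Proof.
have [->|v0] := eqVneq v 0; first by rewrite /bform !mul0mx mxE.
by apply/ltW; case: pS => _; exact.
Qed.

Lemma bform_delta i : bform S (delta_mx 0 i) (delta_mx 0 i) = S i i.
Proof. by rewrite /bform trmx_delta -rowE -colE !mxE. Qed.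

Lemma posdef_diag_gt0 i : 0 < S i i.
Proof.
rewrite -bform_delta; case: pS => _; apply.
apply/negP => /eqP/rowP/(_ i); rewrite !mxE !eqxx => /eqP.
by rewrite oner_eq0.
Qed.

Lemma invmx_sym : (invmx S)^T = invmx S.
Proof. by rewrite trmx_inv; case: pS => ->. Qed.

Lemma bform_invmx u v : bform S (u *m invmx S) v = (u *m v^T) 0 0.
Proof. by rewrite /bform mulmxKV// posdef_unit. Qed.

Lemma bform_invmx2 u v : bform S (u *m invmx S) (v *m invmx S) = bform (invmx S) u v.
Proof. by rewrite bform_invmx trmx_mul invmx_sym mulmxA. Qed.

Lemma invmx_quad_gt0 v : v != 0 -> 0 < bform (invmx S) v v.
Proof.
move=> v0; rewrite -bform_invmx2; case: pS => _; apply.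
by apply: contra v0 => /eqP v0; rewrite -(mulmxKV posdef_unit v) v0 mul0mx.
Qed.

(* Cauchy-Schwarz for the inner product S^-1, applied to v and the i-th row of S. *)
Lemma sqr_le_invquad (v : 'rV[R]_p) i : v 0 i ^+ 2 <= S i i * bform (invmx S) v v.
Proof.
(* The value of t minimising the form of S at v S^-1 - t e_i; its nonnegativity there is the
   claim. *)
pose t := v 0 i / S i i; have S0 := posdef_diag_gt0 i.
have [sS _] := pS.
have := posdef_ge0 (v *m invmx S - t *: delta_mx 0 i).
rewrite bformBl !bformBr !bformZl !bformZr bform_invmx2.
rewrite (bformC (delta_mx 0 i) _ sS) bform_invmx bform_delta trmx_delta -colE mxE.
move=> H; have {H} : 0 <= S i i * (bform (invmx S) v v - t * v 0 i - (t * v 0 i - t * (t * S i i))).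
  by rewrite mulr_ge0// ltW.
move=> H; rewrite -subr_ge0; apply: le_trans H _; rewrite le_eqVlt; apply/orP; left.
apply/eqP; rewrite /t; field.
by rewrite gt_eqF.
Qed.

Lemma bform_upper (A : 'M[R]_p) (v : 'rV[R]_p) :
  bform A v v <= (\sum_i \sum_j `|A i j|) * \sum_i v 0 i ^+ 2.
Proof.
have vi i : v 0 i ^+ 2 <= \sum_i v 0 i ^+ 2.
  by rewrite (bigD1 i)//= lerDl sumr_ge0// => j _; rewrite sqr_ge0.
rewrite bform_sum mulr_suml; apply: ler_sum => i _.
rewrite mulr_suml; apply: ler_sum => j _.
rewrite mulrAC mulrC (le_trans (ler_norm _))// normrM ler_wpM2l// normrM.
have := vi i; have := vi j; rewrite -!(real_normK (num_real (v 0 _))).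
by have := sqr_ge0 (`|v 0 i| - `|v 0 j|); set s := \sum_i _; nra.
Qed.
End posdef_facts.

(** * Bounds on the joint density *)

Section scalar_bounds.
Variable R : realType.
Implicit Types y u t a l : R.

Let oneD (a : R) : 0 < 1 + a ^+ 2. Proof. by rewrite ltr_pwDl ?sqr_ge0. Qed.

(** The right side exceeds the left by 1 + (a + b)^2 + 2 (a b)^2. *)
Lemma oneDsqrB_le a b : 1 + (a - b) ^+ 2 <= 2 * ((1 + a ^+ 2) * (1 + b ^+ 2)).
Proof. by have := sqr_ge0 (a + b); have := sqr_ge0 (a * b); nra. Qed.

(** Two uses of [oneDsqrB_le] give the factor 4; the constant 16 leaves slack. *)
Lemma cauchy_pdf_lower y u t :
  (16 * (pi : R) * (1 + y ^+ 2))^-1 * (1 + u ^+ 2)^-1 * (1 + t ^+ 2)^-1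
  <= cauchy_pdf (y - u - t).
Proof.
have pi0 : 0 < (pi : R) := pi_gt0 R.
rewrite /cauchy_pdf -!invfM lef_pV2 ?posrE ?mulr_gt0 ?oneD//.
rewrite (mulrC 16) -!mulrA ler_pM2l//.
have h1 := oneDsqrB_le (y - u) t; have h2 := oneDsqrB_le y u.
have ha := oneD t; have hb := oneD y; have hc := oneD u.
apply: (le_trans h1); apply: (@le_trans _ _ (2 * ((2 * ((1 + y ^+ 2) * (1 + u ^+ 2))) * (1 + t ^+ 2)))).
  by rewrite ler_pM2l// ler_pM2r.
have := mulr_gt0 (mulr_gt0 hb hc) ha; lra.
Qed.

Lemma cauchy_pdf_upper y u t :
  cauchy_pdf (y - u - t) <=
  4 * (1 + y ^+ 2) / pi * (1 + u ^+ 2) * (1 + t ^+ 2)^-1.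
Proof.
have pi0 : 0 < (pi : R) := pi_gt0 R.
have h1 := oneDsqrB_le (y - u) (y - u - t); have h2 := oneDsqrB_le y u.
have ha := oneD t; have hb := oneD y; have hc := oneD u; have hd := oneD (y - u - t).
rewrite /cauchy_pdf; move: (@pi R) pi0 => q q0; rewrite -[leLHS]div1r ler_pdivrMr ?mulr_gt0//.
rewrite (_ : _ * (q * _) =
  4 * (1 + y ^+ 2) * (1 + u ^+ 2) * (1 + (y - u - t) ^+ 2) / (1 + t ^+ 2)); last first.
  by field; rewrite !gt_eqF.
rewrite ler_pdivlMr// mul1r.
(* Writing t as a difference bounds 1 + t^2 by the Cauchy denominator, which is the reverse
   direction of the comparison. *)
have {1}-> : t = (y - u) - (y - u - t) by ring.
apply: (le_trans h1).
apply: (@le_trans _ _ (2 * ((2 * ((1 + y ^+ 2) * (1 + u ^+ 2))) * (1 + (y - u - t) ^+ 2)))).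
  by rewrite ler_pM2l// ler_pM2r.
by rewrite le_eqVlt; apply/orP; left; apply/eqP; ring.
Qed.

Lemma gauss_exp_decay a l : 0 < l -> exists2 C : R, 0 < C &
  forall t, (1 + t ^+ 2) * expR (a * t - l * t ^+ 2) <= C * (1 + t ^+ 2)^-1.
Proof.
move=> l0; exists ((1 + 4 / l) ^+ 2 * expR (a ^+ 2 / (2 * l))).
  by rewrite mulr_gt0 ?expR_gt0// exprn_gt0// addr_gt0// divr_gt0.
move=> t; rewrite ler_pdivlMr//.
(* A quarter of the Gaussian exponent: exp(s) dominates 1 + t^2 up to a constant, and is used twice.
   The remaining half absorbs the linear term by completing the square. *)
set s := l * t ^+ 2 / 4.
have s0 : 0 <= s by rewrite /s divr_ge0// mulr_ge0 ?sqr_ge0 ?(ltW l0).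
have E1 : expR (a * t - l * t ^+ 2) <= expR (a ^+ 2 / (2 * l)) * (expR s ^+ 2)^-1.
  rewrite -expRM_natl -expRN -expRD ler_expR -subr_ge0.
  rewrite (_ : _ - _ = (a - l * t) ^+ 2 / (2 * l)); last by rewrite /s; field; rewrite gt_eqF.
  by rewrite divr_ge0 ?sqr_ge0// mulr_ge0// ltW.
have E2 : 1 + t ^+ 2 <= (1 + 4 / l) * expR s.
  apply: (@le_trans _ _ ((1 + 4 / l) * (1 + s))); last first.
    by rewrite ler_pM2l ?expR_ge1Dx// addr_gt0// divr_gt0.
  rewrite -subr_ge0 (_ : _ - _ = s + 4 / l); last by rewrite /s; field; rewrite gt_eqF.
  by rewrite addr_ge0// divr_ge0// ltW.
rewrite mulrAC -expr2.
apply: (@le_trans _ _ (((1 + 4 / l) * expR s) ^+ 2 * (expR (a ^+ 2 / (2 * l)) * (expR s ^+ 2)^-1))).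
  apply: ler_pM => //; rewrite ?sqr_ge0 ?expR_ge0//.
  apply: lerXn2r => //; rewrite nnegrE ?(ltW (oneD t))//.
  exact: le_trans (ltW (oneD t)) E2.
rewrite le_eqVlt; apply/orP; left; apply/eqP; field.
by rewrite !gt_eqF ?expR_gt0.
Qed.
End scalar_bounds.

(** * Two-sided bounds on the joint posterior density *)

Section density_bounds.
Variables (R : realType) (p : nat) (S : 'M[R]_p) (y : 'rV[R]_p).
Hypothesis pS : posdef S.

Let oneD (a : R) : 0 < 1 + a ^+ 2. Proof. by rewrite ltr_pwDl ?sqr_ge0. Qed.

Let G := (Num.sqrt ((2 * (pi : R)) ^+ p * \det S))^-1.

Let G_gt0 : 0 < G.
Proof.
rewrite invr_gt0 sqrtr_gt0 mulr_gt0 ?posdef_det_gt0// exprn_gt0//.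
by rewrite mulr_gt0// pi_gt0.
Qed.

Lemma gauss_pdfE v : gauss_pdf S v = G * expR (- bform (invmx S) v v / 2).
Proof. by []. Qed.

Lemma gauss_pdf_lower : exists2 l : R, 0 <= l & forall v : 'rV[R]_p,
  G * \prod_i expR (- l * v 0 i ^+ 2) <= gauss_pdf S v.
Proof.
exists ((\sum_i \sum_j `|invmx S i j|) / 2) => [|v].
  by rewrite divr_ge0// sumr_ge0// => i _; rewrite sumr_ge0.
rewrite gauss_pdfE ler_pM2l// -expR_sum ler_expR -mulr_sumr mulNr.
rewrite mulrAC -mulNr ler_pM2r// lerN2.
exact: bform_upper.
Qed.

(** Averaging v_i^2 <= S_ii Q(v) over the [p] coordinates, Q being the form of S^-1, yields the
    rates 1 / (2 p S_ii). *)
Lemma gauss_pdf_upper : exists2 l : 'I_p -> R, (forall i, 0 < l i) & forall v : 'rV[R]_p,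
  gauss_pdf S v <= G * \prod_i expR (- l i * v 0 i ^+ 2).
Proof.
exists (fun i => (2 * p%:R * S i i)^-1) => [i|v].
  have p0 : (0 < p)%N by case: (p) i => // -[].
  by rewrite invr_gt0 !mulr_gt0 ?ltr0n// posdef_diag_gt0.
rewrite gauss_pdfE ler_pM2l// -expR_sum ler_expR.
under eq_bigr do rewrite mulNr.
rewrite sumrN mulNr lerN2.
have [p0|p0] := posnP p.
  rewrite big1 => [|i _]; last by have := ltn_ord i; rewrite {2}p0.
  by rewrite divr_ge0// -(bform_invmx2 pS) posdef_ge0.
apply: (@le_trans _ _ (\sum_(i < p) (2 * p%:R)^-1 * bform (invmx S) v v)).
  apply: ler_sum => i _; rewrite invfM -mulrA ler_pM2l ?invr_gt0 ?mulr_gt0 ?ltr0n//.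
  by rewrite mulrC ler_pdivrMr ?posdef_diag_gt0// mulrC sqr_le_invquad.
rewrite sumr_const card_ord -mulr_natl le_eqVlt; apply/orP; left; apply/eqP.
by field; rewrite pnatr_eq0 -lt0n.
Qed.

Lemma joint_noncentred_lower : exists2 c : R, 0 < c & exists2 l : R, 0 <= l & forall (u : 'rV[R]_p) t,
  c * (1 + t ^+ 2)^-1 ^+ p * \prod_i ((1 + u 0 i ^+ 2)^-1 * expR (- l * u 0 i ^+ 2))
  <= joint_noncentred S y u t.
Proof.
have [l l0 hl] := gauss_pdf_lower.
exists (G * \prod_i (16 * (pi : R) * (1 + y 0 i ^+ 2))^-1).
  by rewrite mulr_gt0// prodr_gt0// => i _; rewrite invr_gt0 !mulr_gt0 ?pi_gt0.
exists l => // u t; rewrite /joint_noncentred.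
apply: (@le_trans _ _ ((\prod_i ((16 * (pi : R) * (1 + y 0 i ^+ 2))^-1 *
   (1 + u 0 i ^+ 2)^-1 * (1 + t ^+ 2)^-1)) * (G * \prod_i expR (- l * u 0 i ^+ 2)))).
  rewrite !big_split/= prodr_const card_ord le_eqVlt; apply/orP; left; apply/eqP; ring.
apply: ler_pM => //.
- by apply: prodr_ge0 => i _; rewrite !mulr_ge0 ?invr_ge0 ?mulr_ge0 ?pi_ge0// ltW.
- by rewrite mulr_ge0 ?(ltW G_gt0)// prodr_ge0// => i _; rewrite expR_ge0.
apply: ler_prod => i _; rewrite cauchy_pdf_lower andbT.
by rewrite !mulr_ge0 ?invr_ge0 ?mulr_ge0 ?pi_ge0// ltW.
Qed.

(** The exponential factor serves the moment bound of the centred chain; [a = 0] gives the plain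
    upper bound. The Gaussian decay pays for both this factor and the growth 1 + u_i^2 of the Cauchy
    bound. *)
Lemma joint_noncentred_upper (a : 'I_p -> R) : exists2 C : R, 0 < C & forall (u : 'rV[R]_p) t,
  joint_noncentred S y u t * expR (\sum_i a i * u 0 i)
  <= C * (1 + t ^+ 2)^-1 ^+ p * \prod_i (1 + u 0 i ^+ 2)^-1.
Proof.
have [l l0 hl] := gauss_pdf_upper.
have /choice[C hC] : forall i, exists C : R, 0 < C /\ forall t,
    (1 + t ^+ 2) * expR (a i * t - l i * t ^+ 2) <= C * (1 + t ^+ 2)^-1.
  by move=> i; have [C C0 hC] := gauss_exp_decay (a i) (l0 i); exists C.
have cy i : 0 < 4 * (1 + y 0 i ^+ 2) / pi by rewrite divr_gt0 ?pi_gt0// mulr_gt0.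
exists (G * \prod_i (4 * (1 + y 0 i ^+ 2) / pi * C i)).
  by rewrite mulr_gt0// prodr_gt0// => i _; rewrite mulr_gt0//; have [] := hC i.
move=> u t; rewrite /joint_noncentred expR_sum.
apply: (@le_trans _ _ ((\prod_i (4 * (1 + y 0 i ^+ 2) / pi * (1 + u 0 i ^+ 2) * (1 + t ^+ 2)^-1) *
   (G * \prod_i expR (- l i * u 0 i ^+ 2))) * \prod_i expR (a i * u 0 i))).
  apply: ler_wpM2r; first by apply: prodr_ge0 => i _; exact: expR_ge0.
  apply: ler_pM => //.
  - by apply: prodr_ge0 => i _; rewrite /cauchy_pdf invr_ge0 mulr_ge0 ?pi_ge0// ltW.
  - by rewrite gauss_pdfE mulr_ge0 ?expR_ge0// ltW.
  apply: ler_prod => i _; rewrite cauchy_pdf_upper andbT.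
  by rewrite /cauchy_pdf invr_ge0 mulr_ge0 ?pi_ge0// ltW.
apply: (@le_trans _ _ (G * \prod_i (4 * (1 + y 0 i ^+ 2) / pi * (1 + t ^+ 2)^-1 *
    ((1 + u 0 i ^+ 2) * expR (a i * u 0 i - l i * u 0 i ^+ 2))))).
  rewrite mulrCA -!mulrA; rewrite ler_pM2l// -!big_split/= le_eqVlt; apply/orP; left; apply/eqP.
  by apply: eq_bigr => i _; rewrite expRD mulNr; ring.
apply: (@le_trans _ _ (G * \prod_i (4 * (1 + y 0 i ^+ 2) / pi * (1 + t ^+ 2)^-1 *
    (C i * (1 + u 0 i ^+ 2)^-1)))).
  rewrite ler_pM2l//; apply: ler_prod => i _; apply/andP; split.
    by rewrite !mulr_ge0 ?expR_ge0 ?invr_ge0 ?pi_ge0// ltW.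
  rewrite ler_pM2l; first by have [_] := hC i; exact.
  by rewrite mulr_gt0// invr_gt0.
rewrite !big_split/= !prodr_const !card_ord le_eqVlt; apply/orP; left; apply/eqP; ring.
Qed.

Lemma joint_centredE x t : joint_centred S y x t = joint_noncentred S y (x - t *: ones R p) t.
Proof.
rewrite /joint_centred /joint_noncentred; congr (_ * _); apply: eq_bigr => i _.
by rewrite !mxE; congr cauchy_pdf; ring.
Qed.

(* Completing the square in the full conditional of Theta given X = x, which is
   Gaussian with mean the linear form a(x) and variance tau. *)
Lemma gauss_pdf_shift : (0 < p)%N -> exists (a : 'I_p -> R) (tau : R),
  \sum_i a i = 1 /\ forall (x : 'rV[R]_p) t,
  gauss_pdf S (x - (t + tau) *: ones R p) * expR (t + tau) =
  gauss_pdf S (x - t *: ones R p) * expR (\sum_i a i * x 0 i + tau / 2).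
Proof.
move=> p0; set A := invmx S; set e := ones R p.
have e0 : e != 0.
  apply/negP => /eqP/rowP/(_ (Ordinal p0)); rewrite !mxE => /eqP.
  by rewrite oner_eq0.
have q0 : bform A e e != 0 by rewrite gt_eqF// invmx_quad_gt0.
have sA : A^T = A by exact: invmx_sym.
(* The generalised least squares weights: S^-1 1 divided by 1^T S^-1 1, the inverse of that number
   being the variance [tau]. *)
pose a i := (A *m e^T) i 0 / bform A e e.
have aE (x : 'rV[R]_p) : \sum_i a i * x 0 i = bform A x e / bform A e e.
  rewrite {1}/bform -mulmxA mxE mulr_suml; apply: eq_bigr => i _.
  by rewrite /a mulrC mulrA. 
exists a, (bform A e e)^-1; split.
  rewrite -(divff q0) -aE; apply: eq_bigr => i _.
  by rewrite [e 0 i]mxE mulr1.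
move=> x t; rewrite !gauss_pdfE -/A aE -!mulrA -!expRD; congr (_ * expR _).
rewrite !bformBl !bformBr !bformZl !bformZr (bformC e x sA).
by field.
Qed.

Lemma measurable_joint_noncentred : rvmeas (fun t u => (joint_noncentred S y u t)%:E).
Proof.
move=> d T g c mg mc; apply/measurable_EFinP; apply: measurable_funM.
  apply: measurable_prod => i _; apply: measurable_fun_posV.
    by move=> x; rewrite mulr_gt0 ?pi_gt0 ?oneD.
  apply: measurable_funM => //; apply: measurable_funD => //.
  apply: measurable_funX; apply: measurable_funB => //; apply: measurable_funB => //.
  under eq_fun do rewrite mxE; exact: mc.
under eq_fun do rewrite gauss_pdfE bform_sum.
apply: measurable_funM => //; apply: measurableT_comp; first exact: measurable_expR.
apply: measurable_funM => //; apply: measurable_funN.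
apply: measurable_sum => i; apply: measurable_sum => j.
under eq_fun do rewrite !mxE.
by apply: measurable_funM => //; apply: measurable_funM.
Qed.

Lemma measurable_joint_centred : rvmeas (fun t u => (joint_centred S y u t)%:E).
Proof.
move=> d T g c mg mc.
have := measurable_joint_noncentred mg (c := fun i x => c i x - g x).
move=> /(_ (fun i => measurable_funB (mc i) mg)).
apply: eq_measurable_fun => x _; rewrite joint_centredE; congr (joint_noncentred _ _ _ _)%:E.
by apply/rowP => i; rewrite !mxE mulr1.
Qed.
End density_bounds.

(** * Geometric decay against polynomial growth *)

Section exponential_beats_power.
Variable R : realType.

Lemma exp_beats_power (q e : R) k : 0 < q < 1 -> 0 < e ->
  exists n : nat, n.+1%:R ^+ k * q ^+ n < e.
Proof.
move=> /andP[q0 q1] e0.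
pose a := - ln q; have a0 : 0 < a by rewrite /a oppr_gt0 ln_lt0// q0.
have qE n : q ^+ n = expR (- (a * n%:R)).
  by rewrite -mulNr expRM_natr /a opprK lnK.
(* With q = exp(-a), keeping the term of degree k + 1 in the series of exp(a (n + 1)) gives (n +
   1)^k q^n <= D / (n + 1). *)
pose D := (k.+1)`!%:R / (a ^+ k.+1 * q).
have D0 : 0 < D by rewrite divr_gt0 ?ltr0n ?fact_gt0// mulr_gt0// exprn_gt0.
pose n := Num.bound (D / e); exists n.
have n0 : 0 < n.+1%:R :> R by rewrite ltr0n.
have De : D / e < n.+1%:R.
  have De0 : 0 <= D / e by rewrite divr_ge0 ?ltW.
  by apply: lt_le_trans (archi_boundP De0) _; rewrite ler_nat leqnSn.
clearbody n; have H : (a * n.+1%:R) ^+ k.+1 / (k.+1)`!%:R <= expR (a * n.+1%:R).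
  apply: le_trans (expR_ge1Dxn k _); first by rewrite lerDr.
  by rewrite mulr_ge0// ltW.
have f0 : 0 < (k.+1)`!%:R :> R by rewrite ltr0n fact_gt0.
apply: (@le_lt_trans _ _ (D / n.+1%:R)); last first.
  by rewrite ltr_pdivrMr// mulrC -ltr_pdivrMr.
have E : q ^+ n * q * expR (a * n.+1%:R) = 1 by rewrite -exprSr qE -expRD addNr expR0.
rewrite /D ler_pdivlMr// ler_pdivlMr ?mulr_gt0 ?exprn_gt0//.
rewrite ler_pdivrMr// exprMn in H.
have qn : 0 <= q ^+ n * q by rewrite mulr_ge0 ?exprn_ge0// ltW.
have := ler_wpM2l qn H; rewrite mulrA [X in _ <= X](_ : _ =
    q ^+ n * q * expR (a * n.+1%:R) * (k.+1)`!%:R).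
  rewrite E mul1r; apply: le_trans.
  by rewrite [n.+1%:R ^+ k.+1]exprSr !mulrA le_eqVlt; apply/orP; left; apply/eqP;
    move: (n.+1%:R) (q ^+ n) (n.+1%:R ^+ k) (a ^+ k.+1) => N A B C; ring.
by rewrite mulrA.
Qed.
End exponential_beats_power.

(** * Integrals of the comparison functions *)

Section comparison_functions.
Variables (R : realType) (l : R).
Hypothesis l0 : 0 <= l.
Local Notation leb := (@lebesgue_measure R).

Let H (t : R) := (1 + t ^+ 2)^-1.
Let lo (t : R) := (1 + t ^+ 2)^-1 * expR (- l * t ^+ 2).

Lemma inv_oneDsqr_gt0 (t : R) : 0 < (1 + t ^+ 2)^-1.
Proof. by rewrite invr_gt0 ltr_pwDl ?sqr_ge0. Qed.

Lemma inv_oneDsqr_le1 (t : R) : (1 + t ^+ 2)^-1 <= 1.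
Proof. by rewrite invf_le1 ?lerDl ?sqr_ge0// ltr_pwDl ?sqr_ge0. Qed.

Lemma measurable_damped : measurable_fun setT (fun t : R => (1 + t ^+ 2)^-1 * expR (- l * t ^+ 2)).
Proof.
apply: measurable_funM; first exact: measurable_inv_oneDsqr.
apply: measurableT_comp; first exact: measurable_expR.
by apply: measurable_funM => //; exact: measurable_funX.
Qed.

Lemma integral_damped : exists2 I : R, 0 < I &
  (\int[leb]_t ((1 + t ^+ 2)^-1 * expR (- l * t ^+ 2))%:E = I%:E)%E.
Proof.
have lo0 t : 0 < lo t by rewrite mulr_gt0 ?expR_gt0 ?inv_oneDsqr_gt0.
have I0 : (0 < \int[leb]_t (lo t)%:E)%E.
  by apply: integral_gt0 => //; apply/measurable_EFinP; exact: measurable_damped.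
have Ifin : (\int[leb]_t (lo t)%:E)%E \is a fin_num.
  rewrite ge0_fin_numE ?(ltW I0)//.
  apply: (@le_lt_trans _ _ (pi%:E)%E); last by rewrite ltry.
  rewrite -integral_inv_oneDsqr; apply: ge0_le_integralT => t; rewrite lee_fin.
    exact: ltW.
  rewrite ler_piMr ?(ltW (inv_oneDsqr_gt0 t))// -expR0 ler_expR mulNr oppr_le0.
  by rewrite mulr_ge0// sqr_ge0.
exists (fine (\int[leb]_t (lo t)%:E)%E); last by rewrite fineK.
by rewrite -lte_fin fineK.
Qed.

(** The shift [s] covers both samplers: it is 0 in the non-centred one and the current state in the
    centred one. *)
Lemma rvint_between p (f : 'rV[R]_p -> R) (s c C I : R) : 0 <= c -> 0 <= C ->
  (\int[leb]_t ((1 + t ^+ 2)^-1 * expR (- l * t ^+ 2))%:E = I%:E)%E ->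
  (forall u : 'rV[R]_p,
    c * \prod_i ((1 + (u 0 i - s) ^+ 2)^-1 * expR (- l * (u 0 i - s) ^+ 2)) <= f u) ->
  (forall u, f u <= C * \prod_i (1 + (u 0 i - s) ^+ 2)^-1) ->
  exists2 z : R, c * I ^+ p <= z <= C * pi ^+ p & rvint (fun u => (f u)%:E) = z%:E.
Proof.
move=> c0 C0 IE cf fC.
have P (k J : R) (h : R -> R) : 0 <= k -> measurable_fun setT h -> (forall t, 0 <= h t) ->
    (\int[leb]_t (h t)%:E = J%:E)%E ->
    rvint (fun u : 'rV[R]_p => (k * \prod_i h (u 0 i - s))%:E) = (k * J ^+ p)%:E.
  move=> k0 mh h0 hJ.
  have mhs : measurable_fun setT (fun t : R => h (t - s)).
    by apply: measurableT_comp => //; exact: measurable_funB.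
  have hsJ : (\int[leb]_t (h (t - s))%:E = J%:E)%E.
    rewrite -hJ; apply: (integral_shift (f := fun t => (h t)%:E) (- s)).
      exact/measurable_EFinP.
    by move=> t; rewrite lee_fin.
  rewrite EFinM -(rvint_prod p mhs _ hsJ)// -rvintZl//.
    move=> d T g c' mg mc; apply/measurable_EFinP/measurable_prod => i _.
    by under eq_fun do rewrite mxE; exact: (measurableT_comp mhs (mc i)).
  by move=> v; rewrite lee_fin prodr_ge0.
have lo0 t : 0 <= lo t by rewrite ltW// mulr_gt0 ?expR_gt0 ?inv_oneDsqr_gt0.
have H0 t : 0 <= H t by rewrite ltW// inv_oneDsqr_gt0.
have f0 u : 0 <= f u by rewrite (le_trans _ (cf u))// mulr_ge0// prodr_ge0// => i _; exact: lo0.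
have Lo : ((c * I ^+ p)%:E <= rvint (fun u => (f u)%:E))%E.
  rewrite -(P _ _ lo)//; last exact: measurable_damped.
  apply: le_rvint => u; rewrite lee_fin; last exact: cf.
  by rewrite mulr_ge0// prodr_ge0.
have Up : (rvint (fun u => (f u)%:E) <= (C * pi ^+ p)%:E)%E.
  rewrite -(P _ _ H)//; first by apply: le_rvint => u; rewrite lee_fin.
    exact: measurable_inv_oneDsqr.
  exact: integral_inv_oneDsqr.
have fin : rvint (fun u => (f u)%:E) \is a fin_num.
  by rewrite fin_numElt (lt_le_trans _ Lo) ?ltNyr//= (le_lt_trans Up) ?ltry.
exists (fine (rvint (fun u => (f u)%:E))); last by rewrite fineK.
by rewrite -!lee_fin fineK// Lo Up.
Qed.

(** Since [p >= 1], the integrand is dominated by the Cauchy function (1 + t^2)^-1. *)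
Lemma integral_pow_inv_oneDsqr p : (0 < p)%N -> exists2 J : R, 0 < J &
  forall k : R, 0 <= k -> (\int[leb]_t (k * (1 + t ^+ 2)^-1 ^+ p)%:E = (k * J)%:E)%E.
Proof.
move=> p0.
have mHp : measurable_fun setT (fun t : R => (1 + t ^+ 2)^-1 ^+ p).
  by apply: measurable_funX; exact: measurable_inv_oneDsqr.
have Hp0 (t : R) : 0 < (1 + t ^+ 2)^-1 ^+ p by rewrite exprn_gt0 ?inv_oneDsqr_gt0.
have J0 : (0 < \int[leb]_t ((1 + t ^+ 2)^-1 ^+ p)%:E)%E.
  by apply: integral_gt0; [exact/measurable_EFinP|move=> t; rewrite lte_fin].
have Jfin : (\int[leb]_t ((1 + t ^+ 2)^-1 ^+ p)%:E)%E \is a fin_num.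
  rewrite ge0_fin_numE ?(ltW J0)//.
  apply: (@le_lt_trans _ _ (pi%:E)%E); last by rewrite ltry.
  rewrite -integral_inv_oneDsqr; apply: ge0_le_integralT => t; rewrite lee_fin ?(ltW (Hp0 t))//.
  by rewrite -[leRHS]expr1 ler_wiXn2l// ?inv_oneDsqr_le1// ltW// inv_oneDsqr_gt0.
exists (fine (\int[leb]_t ((1 + t ^+ 2)^-1 ^+ p)%:E)%E); first by rewrite -lte_fin fineK.
move=> k k0; rewrite EFinM fineK// -ge0_integralZl_EFin//.
- by move=> t _; rewrite lee_fin ltW.
- exact/measurable_EFinP.
Qed.

Lemma integral_between (f lf uf : R -> R) (a b : R) :
  (forall t, 0 <= lf t <= f t) -> (forall t, f t <= uf t) ->
  (\int[leb]_t (lf t)%:E = a%:E)%E -> (\int[leb]_t (uf t)%:E = b%:E)%E ->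
  exists2 m : R, a <= m <= b & (\int[leb]_t (f t)%:E = m%:E)%E.
Proof.
move=> lff fuf la ub.
have La : (a%:E <= \int[leb]_t (f t)%:E)%E.
  by rewrite -la; apply: ge0_le_integralT => t; rewrite lee_fin; have /andP[] := lff t.
have Lb : (\int[leb]_t (f t)%:E <= b%:E)%E.
  rewrite -ub; apply: ge0_le_integralT => t; rewrite lee_fin//.
  by have /andP[] := lff t; exact: le_trans.
have fin : (\int[leb]_t (f t)%:E)%E \is a fin_num.
  by rewrite fin_numElt (lt_le_trans _ La) ?ltNyr//= (le_lt_trans Lb) ?ltry.
exists (fine (\int[leb]_t (f t)%:E)%E); last by rewrite fineK.
by rewrite -!lee_fin fineK// La Lb.
Qed.
End comparison_functions.

(** * The two samplers *)

Section noncentred_sampler.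
Variables (R : realType) (p : nat) (S : 'M[R]_p) (y : 'rV[R]_p).
Hypotheses (p0 : (0 < p)%N) (pS : posdef S).
Local Notation leb := (@lebesgue_measure R).

Let h (t : R) := (1 + t ^+ 2)^-1 ^+ p.
Let prodH (u : 'rV[R]_p) := \prod_i (1 + u 0 i ^+ 2)^-1.
Let prodlo (l : R) (u : 'rV[R]_p) := \prod_i ((1 + u 0 i ^+ 2)^-1 * expR (- l * u 0 i ^+ 2)).

Let h_gt0 t : 0 < h t. Proof. by rewrite exprn_gt0 ?inv_oneDsqr_gt0. Qed.
Let prodH_gt0 u : 0 < prodH u.
Proof. by apply: prodr_gt0 => i _; exact: inv_oneDsqr_gt0. Qed.
Let prodlo_gt0 l u : 0 < prodlo l u.
Proof. by apply: prodr_gt0 => i _; rewrite mulr_gt0 ?expR_gt0 ?inv_oneDsqr_gt0. Qed.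

Lemma joint_noncentred_le : exists2 C : R, 0 < C & forall u t,
  joint_noncentred S y u t <= C * h t * prodH u.
Proof.
have [C C0 dC] := joint_noncentred_upper y pS (fun=> 0); exists C => // u t.
have := dC u t; rewrite big1 => [|i _]; last by rewrite mul0r.
by rewrite expR0 mulr1.
Qed.

Lemma joint_noncentred_gt0 u t : 0 < joint_noncentred S y u t.
Proof.
have [c c0 [l _ dl]] := joint_noncentred_lower y pS.
by apply: lt_le_trans (dl u t); rewrite !mulr_gt0 ?h_gt0 ?prodlo_gt0.
Qed.

Lemma joint_noncentred_uniformly_ergodic : uniformly_ergodic (joint_noncentred S y).
Proof.
pose d := joint_noncentred S y.
have [c c0 [l l0 dl]] := joint_noncentred_lower y pS.
have [C C0 dC] := joint_noncentred_le.
have [I I0 IE] := integral_damped l0.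
have [J J0 JE] := integral_pow_inv_oneDsqr R p0.
(* The rate doubles because the lower bound on the density enters once for each of the two full
   conditionals. *)
have l20 : 0 <= 2 * l by rewrite mulr_ge0.
have [I2 I20 I2E] := integral_damped l20.
have /choice[z hz] : forall t, exists z : R,
    c * h t * I ^+ p <= z <= C * h t * pi ^+ p /\ rvint (fun u => (d u t)%:E) = z%:E.
  move=> t; have ch : 0 <= c * h t by rewrite ltW ?mulr_gt0.
  have Ch : 0 <= C * h t by rewrite ltW ?mulr_gt0.
  have [||z z1 z2] := rvint_between (f := d^~ t) (s := 0) ch Ch IE.
  - by move=> u; under eq_bigr do rewrite subr0; exact: dl.
  - by move=> u; under eq_bigr do rewrite subr0; exact: dC.
  by exists z.
have z0 t : 0 < z t.
  by have [/andP[+ _] _] := hz t; apply: lt_le_trans; rewrite !mulr_gt0 ?h_gt0 ?exprn_gt0.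
have zE t : rvint (fun u => (d u t)%:E) = (z t)%:E by have [] := hz t.
have /choice[w hw] : forall u, exists w : R,
    c * prodlo l u * J <= w <= C * prodH u * J /\ (\int[leb]_t (d u t)%:E = w%:E)%E.
  move=> u; have [||||w w1 w2] := @integral_between R (d u) (fun t => c * prodlo l u * h t)
    (fun t => C * prodH u * h t) (c * prodlo l u * J) (C * prodH u * J).
  - move=> t; rewrite ltW ?mulr_gt0//= mulrAC; exact: dl.
  - by move=> t; rewrite mulrAC; exact: dC.
  - by rewrite JE// ltW ?mulr_gt0.
  - by rewrite JE// ltW ?mulr_gt0.
  by exists w.
have w0 u : 0 < w u.
  by have [/andP[+ _] _] := hw u; apply: lt_le_trans; rewrite !mulr_gt0.
have wE u : (\int[leb]_t (d u t)%:E = (w u)%:E)%E by have [] := hw u.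
have d0 u t : 0 <= d u t by rewrite ltW ?joint_noncentred_gt0.
have md : rvmeas (fun t u => (d u t)%:E) by exact: measurable_joint_noncentred.
have pi0 : 0 < (pi : R) := pi_gt0 R.
have [||||m /andP[m1 _] mE] := @integral_between R z (fun t => c * I ^+ p * h t)
    (fun t => C * pi ^+ p * h t) (c * I ^+ p * J) (C * pi ^+ p * J).
- by move=> t; rewrite ltW ?mulr_gt0 ?h_gt0 ?exprn_gt0//= mulrAC; have [/andP[]] := hz t.
- by move=> t; rewrite mulrAC; have [/andP[]] := hz t.
- by rewrite JE// ltW ?mulr_gt0 ?h_gt0 ?exprn_gt0.
- by rewrite JE// ltW ?mulr_gt0 ?h_gt0 ?exprn_gt0.
have m0 : 0 < m by apply: lt_le_trans m1; rewrite !mulr_gt0 ?h_gt0 ?exprn_gt0.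
(* The constant left when the lower bounds of the two conditionals are multiplied and u is
   integrated out; it does not involve the current state. *)
pose eta := c ^+ 2 / (C ^+ 2 * pi ^+ p * J) * I2 ^+ p.
have eta0 : 0 < eta by rewrite !mulr_gt0 ?invr_gt0 ?mulr_gt0 ?h_gt0 ?exprn_gt0.
have etaE : eta = c ^+ 2 / (C ^+ 2 * pi ^+ p * J) * I2 ^+ p by [].
clearbody eta.
apply: (@uniformly_ergodic_minorization _ _ _ z w d0 md z0 zE w0 wE m m0 mE
  (fun t => eta * h t) (eta * J)).
- apply: measurable_funM => //; apply: measurable_funX; exact: measurable_inv_oneDsqr.
- by move=> t; rewrite ltW ?mulr_gt0 ?h_gt0.
- exact: JE (ltW eta0).
- by rewrite mulr_gt0.
move=> s t; rewrite (trans_densE z0 zE w0 wE).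
pose k := c ^+ 2 / (C ^+ 2 * pi ^+ p * J) * h t.
have k0 : 0 < k by rewrite !mulr_gt0 ?invr_gt0 ?mulr_gt0 ?h_gt0 ?exprn_gt0.
have kE : k = c ^+ 2 / (C ^+ 2 * pi ^+ p * J) * h t by [].
clearbody k.
apply: (@le_trans _ _ (rvint (fun u => (k * prodlo (2 * l) u)%:E))).
  have [||x /andP[x1 _] ->] := @rvint_between _ (2 * l) p (fun u => k * prodlo (2 * l) u)
    0 k k I2 (ltW k0) (ltW k0) I2E.
  - by move=> u; under eq_bigr do rewrite subr0.
  - move=> u; under [in leRHS]eq_bigr do rewrite subr0.
    rewrite ler_pM2l//; apply: ler_prod => i _.
    rewrite ltW ?mulr_gt0 ?expR_gt0 ?inv_oneDsqr_gt0//=.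
    rewrite ler_piMr ?(ltW (inv_oneDsqr_gt0 _))// -[leRHS]expR0 ler_expR mulNr oppr_le0.
    by apply: mulr_ge0 => //; exact: sqr_ge0.
  by rewrite lee_fin (le_trans _ x1)// etaE kE mulrAC.
apply: le_rvint => u; rewrite lee_fin; first by rewrite ltW ?mulr_gt0.
(* The two lower bounds over the upper bound for [w] again have product form, with rate 2 l. *)
have plo : prodlo (2 * l) u = prodlo l u ^+ 2 / prodH u.
  rewrite /prodlo /prodH -prodrXl -prodf_div; apply: eq_bigr => i _.
  rewrite invrK exprMn -expRM_natl -mulrA.
  rewrite (_ : 2 * (- l * u 0 i ^+ 2) = - (2 * l) * u 0 i ^+ 2); last by ring.
  rewrite mulrA mulrAC; congr (_ * _); rewrite expr2 -mulrA mulVf ?mulr1//.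
  by rewrite -[_ + _]invrK invr_neq0// gt_eqF ?inv_oneDsqr_gt0.
(* The factor [h s] occurs in the bounds of numerator and denominator alike and cancels: this is the
   uniformity in [s]. *)
have a1 : c * prodlo l u / (C * pi ^+ p) <= d u s / z s.
  rewrite ler_pdivrMr ?mulr_gt0 ?h_gt0 ?exprn_gt0// mulrAC ler_pdivlMr//.
  have [/andP[_ zs] _] := hz s.
  apply: (@le_trans _ _ (c * prodlo l u * (C * h s * pi ^+ p))).
    by rewrite ler_pM2l ?mulr_gt0.
  rewrite (_ : _ * _ = (c * h s * prodlo l u) * (C * pi ^+ p)); last by ring.
  by rewrite ler_pM2r ?mulr_gt0 ?h_gt0 ?exprn_gt0// dl.
have a2 : c * h t * prodlo l u / (C * prodH u * J) <= d u t / w u.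
  have [/andP[_ wu] _] := hw u.
  have lo0 : 0 < c * h t * prodlo l u by rewrite !mulr_gt0 ?h_gt0.
  have up0 : 0 < C * prodH u * J by rewrite !mulr_gt0.
  apply: ler_pM; [exact: ltW|by rewrite invr_ge0 ltW|exact: dl|].
  by rewrite lef_pV2 ?posrE.
rewrite plo (_ : k * _ = (c * prodlo l u / (C * pi ^+ p)) * (c * h t * prodlo l u / (C * prodH u * J))).
  by apply: ler_pM => //; rewrite ltW// ?mulr_gt0 ?invr_gt0 ?mulr_gt0 ?h_gt0 ?exprn_gt0.
rewrite kE; have := gt_eqF (prodH_gt0 u); have := gt_eqF (exprn_gt0 p pi0).
move: (pi ^+ p) (prodH u) (prodlo l u) (h t) => q P L x q0 P0; field.
by rewrite P0 q0 !gt_eqF.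
Qed.
End noncentred_sampler.

(** * Centred sampler: normalizers and exponential moments *)

Section centred_bounds.
Variables (R : realType) (p : nat) (S : 'M[R]_p) (y : 'rV[R]_p).
Hypotheses (p0 : (0 < p)%N) (pS : posdef S).
Local Notation leb := (@lebesgue_measure R).

Let h (t : R) := (1 + t ^+ 2)^-1 ^+ p.

Let h_gt0 t : 0 < h t. Proof. by rewrite exprn_gt0 ?inv_oneDsqr_gt0. Qed.

Let centerE (u : 'rV[R]_p) t i : (u - t *: ones R p) 0 i = u 0 i - t.
Proof. by rewrite !mxE mulr1. Qed.

Lemma joint_centred_normalizer_bounds : exists2 k : R * R, 0 < k.1 /\ 0 < k.2 &
  exists z : R -> R, forall t, k.1 * h t <= z t <= k.2 * h t /\
    rvint (fun u => (joint_centred S y u t)%:E) = (z t)%:E.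
Proof.
have pi0 : 0 < (pi : R) := pi_gt0 R.
have [c c0 [l l0 dl]] := joint_noncentred_lower y pS.
have [C C0 dC] := joint_noncentred_le y pS.
have [I I0 IE] := integral_damped l0.
exists (c * I ^+ p, C * pi ^+ p) => /=; first by rewrite !mulr_gt0 ?exprn_gt0.
suff /choice : forall t, exists z : R, c * I ^+ p * h t <= z <= C * pi ^+ p * h t /\
  rvint (fun u => (joint_centred S y u t)%:E) = z%:E by case=> z hz; exists z.
move=> t; have ch : 0 <= c * h t by rewrite ltW ?mulr_gt0 ?h_gt0.
have Ch : 0 <= C * h t by rewrite ltW ?mulr_gt0 ?h_gt0.
have [||z z1 z2] := rvint_between (f := joint_centred S y ^~ t) (s := t) ch Ch IE.
- move=> u; rewrite joint_centredE; apply: le_trans (dl _ _); rewrite le_eqVlt; apply/orP; left.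
  by apply/eqP; congr (_ * _); apply: eq_bigr => i _; rewrite centerE.
- move=> u; rewrite joint_centredE; apply: le_trans (dC _ _) _; rewrite le_eqVlt; apply/orP; left.
  by apply/eqP; congr (_ * _); apply: eq_bigr => i _; rewrite centerE.
by exists z; rewrite (mulrAC c) (mulrAC C).
Qed.

Lemma joint_centred_thnormalizer : exists w : 'rV[R]_p -> R, forall u, 0 < w u /\
  (\int[leb]_t (joint_centred S y u t)%:E = (w u)%:E)%E.
Proof.
suff /choice : forall u, exists w : R, 0 < w /\
  (\int[leb]_t (joint_centred S y u t)%:E = w%:E)%E by case=> w hw; exists w.
move=> u.
have [C C0 dC] := joint_noncentred_le y pS.
have [J J0 JE] := integral_pow_inv_oneDsqr R p0.
have d0 t : 0 < joint_centred S y u t by rewrite joint_centredE joint_noncentred_gt0.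
have I0 : (0 < \int[leb]_t (joint_centred S y u t)%:E)%E.
  apply: integral_gt0; last by move=> t; rewrite lte_fin.
  exact: (rvmeas_fst u (measurable_joint_centred S y)).
have fin : (\int[leb]_t (joint_centred S y u t)%:E)%E \is a fin_num.
  rewrite ge0_fin_numE ?(ltW I0)//.
  apply: (@le_lt_trans _ _ ((C * J)%:E)%E); last by rewrite ltry.
  rewrite -(JE C (ltW C0)); apply: ge0_le_integralT => t; rewrite lee_fin; first exact: ltW.
  (* The factors 1 / (1 + (u_i - t)^2) are bounded by 1, which leaves the integrable [C * h t]. *)
  rewrite joint_centredE (le_trans (dC _ _))// ler_piMr ?mulr_ge0 ?(ltW C0) ?(ltW (h_gt0 t))//.
  rewrite -[leRHS](@big1_eq _ 1 *%R _ (index_enum 'I_p) xpredT).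
  by apply: ler_prod => i _; rewrite inv_oneDsqr_le1 ltW ?inv_oneDsqr_gt0.
exists (fine (\int[leb]_t (joint_centred S y u t)%:E)%E); rewrite fineK//; split => //.
by rewrite -lte_fin fineK.
Qed.

(** Given x, the next state has exponential moment exp(a(x) + tau / 2). As a(1) = 1, the factor
    exp(s) splits off and exp(a(x - s 1)) is integrable uniformly in [s]. *)
Lemma joint_centred_exp_moment : exists2 D : R, 0 < D & forall s,
  (\int[leb]_t (trans_dens (joint_centred S y) s t * (expR t)%:E) <= (D * expR s)%:E)%E.
Proof.
pose d := joint_centred S y.
have pi0 : 0 < (pi : R) := pi_gt0 R.
have [[k1 k2]/= [k10 k20] [z hz]] := joint_centred_normalizer_bounds.
have [w hw] := joint_centred_thnormalizer.
have w0 u : 0 < w u by have [] := hw u.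
have wE u : (\int[leb]_t (d u t)%:E = (w u)%:E)%E by have [] := hw u.
have z0 t : 0 < z t.
  by have [/andP[+ _] _] := hz t; apply: lt_le_trans; rewrite mulr_gt0 ?h_gt0.
have zE t : rvint (fun u => (d u t)%:E) = (z t)%:E by have [] := hz t.
have d0 u t : 0 <= d u t by rewrite /d joint_centredE ltW ?joint_noncentred_gt0.
have md : rvmeas (fun t u => (d u t)%:E) by exact: measurable_joint_centred.
have [a [tau [a1 shiftE]]] := gauss_pdf_shift pS p0.
have [C C0 dC] := joint_noncentred_upper y pS a.
exists (C / k1 * expR (tau / 2) * pi ^+ p).
  by rewrite !mulr_gt0 ?expR_gt0 ?invr_gt0 ?exprn_gt0.
move=> s.
rewrite (integral_trans_dens d0 md z0 zE w0 wE); last 2 first.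
- exact: measurable_expR.
- exact: expR_ge0.
(* Translating [t] by [tau] turns the tilted Gaussian back into the original one, so the integral is
   a multiple of [w u]. *)
have dtau u : (\int[leb]_t (d u t * expR t)%:E =
    (expR (\sum_i a i * u 0 i + tau / 2) * w u)%:E)%E.
  have mdu : measurable_fun setT (fun t => (d u t)%:E) by exact: rvmeas_fst md.
  rewrite -(integral_shift (f := fun t => (d u t * expR t)%:E) tau); last 2 first.
  - by apply/measurable_EFinP/measurable_funM; [exact/measurable_EFinP|exact: measurable_expR].
  - by move=> t; rewrite lee_fin mulr_ge0 ?expR_ge0.
  rewrite EFinM -wE -ge0_integralZl_EFin ?expR_ge0//; last first.
    by move=> t _; rewrite lee_fin.
  apply: eq_integral => t _; rewrite -EFinM; congr EFin.
  by rewrite /d /joint_centred -mulrA shiftE mulrA mulrC.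
have ch : 0 <= C / k1 * expR (tau / 2) * expR s.
  by rewrite !mulr_ge0 ?expR_ge0 ?invr_ge0 ?ltW.
pose k := C / k1 * expR (tau / 2) * expR s.
have k0 : 0 <= k by exact: ch.
have kE : k = C / k1 * expR (tau / 2) * expR s by [].
clearbody k.
pose P (u : 'rV[R]_p) := k * \prod_i (1 + (u 0 i - s) ^+ 2)^-1.
apply: (@le_trans _ _ (rvint (fun u => (P u)%:E))).
  apply: le_rvint => u; rewrite dtau -!EFinM lee_fin.
    apply: mulr_ge0; first exact: divr_ge0 (d0 u s) (ltW (z0 s)).
    by apply: mulr_ge0; rewrite ?invr_ge0 ?mulr_ge0 ?expR_ge0 ?(ltW (w0 u)).
  have sumE : \sum_i a i * u 0 i = \sum_i a i * (u 0 i - s) + s.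
    under [in RHS]eq_bigr do rewrite mulrBr.
    by rewrite sumrB -mulr_suml a1 mul1r subrK.
  have {dC} := dC (u - s *: ones R p) s; rewrite -joint_centredE -/(d u s).
  rewrite (eq_bigr (fun i => a i * (u 0 i - s))) => [|i _]; last by rewrite centerE.
  rewrite [\prod_i _](eq_bigr (fun i => (1 + (u 0 i - s) ^+ 2)^-1)) => [|i _]; last by rewrite centerE.
  rewrite sumE !expRD -/(h s) /P kE.
  set e1 := expR (\sum_i _); set Pr := \prod_i _ => dC.
  have e10 : 0 <= e1 by exact: expR_ge0.
  have Pr0 : 0 <= Pr by apply: prodr_ge0 => i _; rewrite ltW ?inv_oneDsqr_gt0.
  rewrite [leLHS](_ : _ = (d u s * e1) / z s * (expR (tau / 2) * expR s)); last first.
    have := gt_eqF (w0 u); have := gt_eqF (z0 s); move: (d u s) (z s) (w u) => dd zz ww zz0 ww0; field.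
    by rewrite zz0 ww0.
  rewrite [leRHS](_ : _ = C / k1 * Pr * (expR (tau / 2) * expR s)); last by ring.
  rewrite ler_wpM2r ?mulr_ge0 ?expR_ge0// ler_pdivrMr//; apply: le_trans dC _.
  have [/andP[zs _] _] := hz s.
  apply: (@le_trans _ _ (C / k1 * Pr * (k1 * h s))).
    by rewrite le_eqVlt; apply/orP; left; apply/eqP; field; rewrite gt_eqF.
  by rewrite ler_wpM2l// !mulr_ge0 ?invr_ge0// ltW.
(* Only the upper estimate matters here, so the lower constant and the damping rate are taken to be
   0. *)
have [I I0 IE] := integral_damped (lexx (0 : R)).
have [||x /andP[_ x1] ->] := rvint_between (f := P) (s := s) (lexx 0) k0 IE.
- move=> u; rewrite mul0r mulr_ge0// prodr_ge0// => i _; rewrite ltW ?inv_oneDsqr_gt0//.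
- by [].
by rewrite lee_fin (le_trans x1)// kE mulrAC.
Qed.
End centred_bounds.

(** * Centred sampler: polynomial posterior tail against slow moves *)

Section centred_sampler.
Variables (R : realType) (p : nat) (S : 'M[R]_p) (y : 'rV[R]_p).
Hypotheses (p0 : (0 < p)%N) (pS : posdef S).
Local Notation leb := (@lebesgue_measure R).

Let h (t : R) := (1 + t ^+ 2)^-1 ^+ p.

Let h_gt0 t : 0 < h t. Proof. by rewrite exprn_gt0 ?inv_oneDsqr_gt0. Qed.

Let d := joint_centred S y.

Let d0 u t : 0 <= d u t.
Proof. by rewrite /d joint_centredE ltW ?joint_noncentred_gt0. Qed.

Let md : rvmeas (fun t u => (d u t)%:E).
Proof. exact: measurable_joint_centred. Qed.

(** The unit interval from T to T + 1 already carries this mass, because [h] is smallest at its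
    right end. *)
Lemma post_centred_tail : exists2 k : R, 0 < k & forall T : R, 0 <= T ->
  ((k * h (T + 1))%:E <= post_Theta (joint_centred S y) `]T, +oo[)%E.
Proof.
have [[k1 k2]/= [k10 k20] [z hz]] := joint_centred_normalizer_bounds y pS.
have z0 t : 0 < z t.
  by have [/andP[+ _] _] := hz t; apply: lt_le_trans; rewrite mulr_gt0 ?h_gt0.
have zE t : rvint (fun u => (d u t)%:E) = (z t)%:E by have [] := hz t.
have [J J0 JE] := integral_pow_inv_oneDsqr R p0.
have mz := measurable_normalizer d0 md zE.
have [||||m /andP[m1 _] mE] := @integral_between R z (fun t => k1 * h t)
    (fun t => k2 * h t) (k1 * J) (k2 * J).
- by move=> t; rewrite ltW ?mulr_gt0 ?h_gt0//=; have [/andP[]] := hz t.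
- by move=> t; have [/andP[]] := hz t.
- exact: JE (ltW k10).
- exact: JE (ltW k20).
have m0 : 0 < m by apply: lt_le_trans m1; rewrite mulr_gt0.
exists (k1 / m) => [|T T0]; first by rewrite divr_gt0.
rewrite (post_ThetaE zE m0 mE) mulrAC EFinM; apply: lee_wpmul2r.
  by rewrite lee_fin invr_ge0 ltW.
have zge0 (t : R) : (0 <= (z t)%:E)%E by rewrite lee_fin ltW.
have mzE : measurable_fun setT (EFin \o z) by exact/measurable_EFinP.
apply: (@le_trans _ _ (\int[leb]_(t in `]T, (T + 1)%R]) (z t)%:E)%E); last first.
  apply: ge0_subset_integral => //; first exact: measurable_funS mzE.
  by move=> t /=; rewrite !in_itv/= andbT => /andP[].
apply: (@le_trans _ _ (\int[leb]_(t in `]T, (T + 1)%R]) (cst (k1 * h (T + 1)%R)%:E t))%E).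
  rewrite integral_cst//= lebesgue_measure_itv/= lte_fin ltrDl ltr01.
  by rewrite -EFinB -EFinM addrAC subrr add0r mulr1.
apply: ge0_le_integral => //.
- by move=> t _; rewrite lee_fin mulr_ge0// ltW.
- exact: measurable_funS mzE.
move=> t /=; rewrite in_itv/= => /andP[Tt tT]; rewrite lee_fin.
have [/andP[zt _] _] := hz t; apply: le_trans zt; rewrite ler_pM2l//.
have oneD (a : R) : 0 < 1 + a ^+ 2 by rewrite ltr_pwDl ?sqr_ge0.
have t0 : 0 <= t by rewrite ltW// (le_lt_trans T0).
have T10 : 0 <= T + 1 by rewrite addr_ge0.
have sq : t ^+ 2 <= (T + 1) ^+ 2 by apply: lerXn2r.
apply: lerXn2r; rewrite ?nnegrE ?(ltW (inv_oneDsqr_gt0 _))//.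
by rewrite lef_pV2 ?posrE// lerD2l.
Qed.

Lemma joint_centred_not_geometrically_ergodic :
  ~ geometrically_ergodic (joint_centred S y).
Proof.
move=> [r [M [/andP[r0 r1] tv]]].
have [k k0 post_ge] := post_centred_tail.
have [D D0 expD] := joint_centred_exp_moment y p0 pS.
have [[k1 k2]/= [k10 k20] [z hz]] := joint_centred_normalizer_bounds y pS.
have z0 t : 0 < z t.
  by have [/andP[+ _] _] := hz t; apply: lt_le_trans; rewrite mulr_gt0 ?h_gt0.
have zE t : rvint (fun u => (d u t)%:E) = (z t)%:E by have [] := hz t.
have [w hw] := joint_centred_thnormalizer y p0 pS.
have w0 u : 0 < w u by have [] := hw u.
have wE u : (\int[leb]_t (d u t)%:E = (w u)%:E)%E by have [] := hw u.
have tail := nstep_exp_tail d0 md z0 zE w0 wE (ltW D0) expD.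
(* One rate for both errors; the 1/2 also keeps it positive when [r] is 0. *)
pose q := Num.max r (2^-1).
have q0 : 0 < q by rewrite lt_max invr_gt0 ltr0n orbT.
have q1 : q < 1 by rewrite gt_max r1/= invf_lt1 ?ltr1n.
pose M0 := `|M 0| + 1; have M00 : 0 < M0 by rewrite ltr_wpDl.
(* The threshold grows by [L] per step, and exp(L) >= 1 + L makes D exp(-L) at most 1/2. *)
pose L := 2 * D; have L0 : 0 < L by rewrite mulr_gt0.
have DL : D * expR (- L) <= 2^-1.
  rewrite expRN ler_pdivrMr ?expR_gt0// mulrC ler_pdivlMr//.
  by rewrite mulrC (le_trans _ (expR_ge1Dx L))// lerDr.
(* Starting at 0, the posterior tail beyond n L is at most the n-step tail, which is below q^n, plus
   the total variation error, which is below |M(0)| q^n. *)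
have key n : k * h (n%:R * L + 1) <= M0 * q ^+ n.
  have T0 : 0 <= n%:R * L by rewrite mulr_ge0// ltW.
  set A : set R := [set` `]n%:R * L, +oo[].
  have mA : measurable A by exact: measurable_itv.
  have P1 := post_ge _ T0.
  have P2 := tail n 0 (n%:R * L); rewrite -/A in P1 P2.
  have P3 : (`|nstep d n 0 A - post_Theta d A| <= (M 0 * r ^+ n)%:E)%E.
    apply: le_trans (tv 0 n); apply: ereal_sup_ubound; by exists A.
  have N := nstep_fin d0 md z0 zE w0 wE mA n 0.
  (* An infinite value would contradict the finite total variation bound. *)
  have PA : post_Theta d A \is a fin_num.
    move: P1 P3; rewrite -/d N; case: (post_Theta d A) => //=.
  move: P1 P2 P3; rewrite -/d N -(fineK PA) -EFinB !lee_fin => P1 P2 P3.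
  have P4 : D ^+ n * expR (0 - n%:R * L) <= q ^+ n.
    rewrite sub0r -mulrN expRM_natl -exprMn.
    apply: lerXn2r; rewrite ?nnegrE ?mulr_ge0 ?expR_ge0 ?(ltW D0) ?(ltW q0)//.
    by rewrite (le_trans DL)// le_max lexx orbT.
  have P5 : M 0 * r ^+ n <= `|M 0| * q ^+ n.
    apply: (@le_trans _ _ (`|M 0| * r ^+ n)); first by rewrite ler_wpM2r ?exprn_ge0// ler_norm.
    by rewrite ler_wpM2l// lerXn2r ?nnegrE ?(ltW q0)// le_max lexx.
  have P6 := lerNnormlW P3.
  move: P1 P2 P4 P5 P6; rewrite /M0 mulrDl mul1r.
  lra.
(* Since n L + 1 <= (n + 1) (L + 1), the tail bound decays at most like (n + 1)^(-2p), which
   [exp_beats_power] plays against q^n. *)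
pose B := 1 + (L + 1) ^+ 2; have B0 : 0 < B by rewrite ltr_pwDl ?sqr_ge0.
have hB n : (B ^+ p)^-1 <= n.+1%:R ^+ (2 * p) * h (n%:R * L + 1).
  rewrite /h exprVn ler_pdivlMr; last by rewrite exprn_gt0// ltr_pwDl ?sqr_ge0.
  rewrite mulrC ler_pdivrMr ?exprn_gt0// exprM -exprMn.
  apply: lerXn2r; rewrite ?nnegrE ?mulr_ge0 ?sqr_ge0 ?(ltW B0) ?addr_ge0 ?sqr_ge0//.
  rewrite /B -natr1; have : 0 <= n%:R :> R by []; move: (n%:R : R) => N N0.
  have h1 : 0 <= N * L by rewrite mulr_ge0// ltW.
  have : N * L + 1 <= (N + 1) * (L + 1) by nra.
  have : (N * L + 1) ^+ 2 <= ((N + 1) * (L + 1)) ^+ 2.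
    rewrite lerXn2r ?nnegrE; nra.
  rewrite exprMn; nra.
have [||n hn] := @exp_beats_power R q (k / B ^+ p / M0) (2 * p).
- by rewrite q0.
- by rewrite !divr_gt0 ?exprn_gt0.
have := key n; rewrite leNgt => /negP; apply.
move: hn; rewrite ltr_pdivlMr// => hn.
have N0 : 0 < n.+1%:R ^+ (2 * p) :> R by rewrite exprn_gt0.
rewrite -(ltr_pM2l N0) (lt_le_trans _ (_ : k * (B ^+ p)^-1 <= _))//.
  by move: hn; rewrite mulrA -[_ * M0]mulrA [q ^+ n * _]mulrC !mulrA.
by rewrite mulrCA ler_pM2l.
Qed.
End centred_sampler.

Theorem mainTheorem9 (R : realType) (p : nat) (S : 'M[R]_p) (y : 'rV[R]_p) :
  (0 < p)%N -> posdef S ->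
  ~ geometrically_ergodic (joint_centred S y) /\
  uniformly_ergodic (joint_noncentred S y).
Proof.
move=> p0 pS; split; first exact: joint_centred_not_geometrically_ergodic.
exact: joint_noncentred_uniformly_ergodic.
Qed.
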